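(* The derivability problem for the multiplicative fragment $\mathcal{M}^{\mathrm{mult}}_{2015}$ of Morrill's calculus with stoups defined below is algorithmically undecidable.
   Context: Formulae are built from a countable set of variables and the constant $\mathbf{1}$ by the binary connectives $\backslash$, $/$, $\cdot$ (and, in the full calculus, $\wedge,\vee$) and the unary connectives $\langle\rangle$, $[]^{-1}$ and $!$. A stoup is a finite multiset of formulae ($\varnothing$ empty). A tree term is a formula or $[\Xi]$ with $\Xi$ a meta-formula; a meta-formula is $\zeta;\Gamma$ with $\zeta$ a stoup and $\Gamma$ a finite linearly ordered sequence of tree terms (empty sequence $\Lambda$); $\varnothing;\Gamma$ is written $\Gamma$. Comma denotes concatenation of sequences and multiset union of stoups; $\zeta,A$ adds a copy of $A$. A sequent is $\Xi\to C$. $\Xi(\Theta)$ denotes a meta-formula with a designated occurrence of a meta-formula $\Theta$ which is $\Xi$ itself or the content of some bracket $[\Theta]$ at any depth; $\Xi(\Theta')$ is the result of replacement. The calculus $\mathcal{M}^{\mathrm{mult}}_{2015}$ uses formulae without $\wedge,\vee$ and has: axioms $A\to A$, $\Lambda\to\mathbf1$; ($/L$) from $\zeta_1;\Gamma\to B$ and $\Xi(\zeta_2;\Delta_1,C,\Delta_2)\to D$ infer $\Xi(\zeta_1,\zeta_2;\Delta_1,C/B,\Gamma,\Delta_2)\to D$; ($/R$) from $\zeta;\Gamma,B\to C$ infer $\zeta;\Gamma\to C/B$; ($\backslash L$) from $\zeta_1;\Gamma\to A$ and $\Xi(\zeta_2;\Delta_1,C,\Delta_2)\to D$ infer $\Xi(\zeta_1,\zeta_2;\Delta_1,\Gamma,A\backslash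 C,\Delta_2)\to D$; ($\backslash R$) from $\zeta;A,\Gamma\to C$ infer $\zeta;\Gamma\to A\backslash C$; ($\cdot L$) from $\Xi(\zeta;\Delta_1,A,B,\Delta_2)\to D$ infer $\Xi(\zeta;\Delta_1,A\cdot B,\Delta_2)\to D$; ($\cdot R$) from $\zeta_1;\Delta\to A$ and $\zeta_2;\Gamma\to B$ infer $\zeta_1,\zeta_2;\Delta,\Gamma\to A\cdot B$; ($\mathbf1L$) from $\Xi(\zeta;\Delta_1,\Delta_2)\to A$ infer $\Xi(\zeta;\Delta_1,\mathbf1,\Delta_2)\to A$; ($[]^{-1}L$) from $\Xi(\zeta;\Delta_1,A,\Delta_2)\to B$ infer $\Xi(\zeta;\Delta_1,[[]^{-1}A],\Delta_2)\to B$; ($[]^{-1}R$) from $[\Xi]\to A$ infer $\Xi\to[]^{-1}A$; ($\langle\rangle L$) from $\Xi(\zeta;\Delta_1,[A],\Delta_2)\to B$ infer $\Xi(\zeta;\Delta_1,\langle\rangle A,\Delta_2)\to B$; ($\langle\rangle R$) from $\Xi\to A$ infer $[\Xi]\to\langle\rangle A$; ($!L$) from $\Xi(\zeta,A;\Gamma_1,\Gamma_2)\to B$ infer $\Xi(\zeta;\Gamma_1,!A,\Gamma_2)\to B$; ($!P$) from $\Xi(\zeta;\Gamma_1,A,\Gamma_2)\to B$ infer $\Xi(\zeta,A;\Gamma_1,\Gamma_2)\to B$; ($!R$) from $\zeta;\Lambda\to B$ infer $\zeta;\Lambda\to!B$; ($!C$) from $\Xi(\zeta_1,\zeta_2;\Gamma_1,[\zeta_2;\Gamma_2],\Gamma_3)\to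 B$ infer $\Xi(\zeta_1,\zeta_2;\Gamma_1,\Gamma_2,\Gamma_3)\to B$, provided $\zeta_2\neq\varnothing$. Here $A,B,C,D$ are formulae, $\Gamma,\Delta,\Delta_i,\Gamma_i$ sequences of tree terms, $\zeta,\zeta_i$ stoups. Cut is not a rule. *)

(* Defs.v *)
From Stdlib Require Import List Arith Permutation.
Import ListNotations.

Inductive formula : Type :=
| Var   : nat -> formula
| One   : formula
| Under : formula -> formula -> formula    (* Under A C  =  A \ C *)
| Over  : formula -> formula -> formula    (* Over C B   =  C / B *)
| Prod  : formula -> formula -> formula
| Dia   : formula -> formula
| BoxInv : formula -> formula
| Bang  : formula -> formula.

(** A stoup is a finite multiset of formulae, represented by a list taken
    up to permutation (see rule [d_perm]). *)
Definition stoup := list formula.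

(** Tree terms: a formula, or a bracketed meta-formula [zeta; Gamma]. *)
Inductive tree : Type :=
| TF : formula -> tree
| TB : stoup -> list tree -> tree.

Definition meta : Type := (stoup * list tree)%type.

(** Contexts Xi(.) : a designated occurrence of a meta-formula, which is
    either the whole meta-formula or the content of a bracket at any depth. *)
Inductive ctx : Type :=
| Hole : ctx
| InBr : stoup -> list tree -> ctx -> list tree -> ctx.

Fixpoint plug (X : ctx) (T : meta) : meta :=
  match X with
  | Hole => T
  | InBr z G1 X' G2 => (z, G1 ++ TB (fst (plug X' T)) (snd (plug X' T)) :: G2)
  end.

Definition sequent : Type := (meta * formula)%type.

Inductive derivable : meta -> formula -> Prop :=
| d_ax : forall A, derivable ([], [TF A]) A
| d_oneR : derivable ([], []) One
| d_overL : forall X z1 z2 G D1 D2 B C D,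
    derivable (z1, G) B ->
    derivable (plug X (z2, D1 ++ TF C :: D2)) D ->
    derivable (plug X (z1 ++ z2, D1 ++ TF (Over C B) :: G ++ D2)) D
| d_overR : forall z G B C,
    derivable (z, G ++ [TF B]) C -> derivable (z, G) (Over C B)
| d_underL : forall X z1 z2 G D1 D2 A C D,
    derivable (z1, G) A ->
    derivable (plug X (z2, D1 ++ TF C :: D2)) D ->
    derivable (plug X (z1 ++ z2, D1 ++ G ++ TF (Under A C) :: D2)) D
| d_underR : forall z G A C,
    derivable (z, TF A :: G) C -> derivable (z, G) (Under A C)
| d_prodL : forall X z D1 D2 A B D,
    derivable (plug X (z, D1 ++ TF A :: TF B :: D2)) D ->
    derivable (plug X (z, D1 ++ TF (Prod A B) :: D2)) D
| d_prodR : forall z1 z2 D G A B,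
    derivable (z1, D) A -> derivable (z2, G) B ->
    derivable (z1 ++ z2, D ++ G) (Prod A B)
| d_oneL : forall X z D1 D2 A,
    derivable (plug X (z, D1 ++ D2)) A ->
    derivable (plug X (z, D1 ++ TF One :: D2)) A
| d_boxinvL : forall X z D1 D2 A B,
    derivable (plug X (z, D1 ++ TF A :: D2)) B ->
    derivable (plug X (z, D1 ++ TB [] [TF (BoxInv A)] :: D2)) B
| d_boxinvR : forall Xi A,
    derivable ([], [TB (fst Xi) (snd Xi)]) A -> derivable Xi (BoxInv A)
| d_diaL : forall X z D1 D2 A B,
    derivable (plug X (z, D1 ++ TB [] [TF A] :: D2)) B ->
    derivable (plug X (z, D1 ++ TF (Dia A) :: D2)) B
| d_diaR : forall Xi A,
    derivable Xi A -> derivable ([], [TB (fst Xi) (snd Xi)]) (Dia A)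
| d_bangL : forall X z G1 G2 A B,
    derivable (plug X (z ++ [A], G1 ++ G2)) B ->
    derivable (plug X (z, G1 ++ TF (Bang A) :: G2)) B
| d_bangP : forall X z G1 G2 A B,
    derivable (plug X (z, G1 ++ TF A :: G2)) B ->
    derivable (plug X (z ++ [A], G1 ++ G2)) B
| d_bangR : forall z B,
    derivable (z, []) B -> derivable (z, []) (Bang B)
| d_bangC : forall X z1 z2 G1 G2 G3 B,
    z2 <> [] ->
    derivable (plug X (z1 ++ z2, G1 ++ TB z2 G2 :: G3)) B ->
    derivable (plug X (z1 ++ z2, G1 ++ G2 ++ G3)) B
(* stoups are multisets: any stoup may be replaced by a permutation of it *)
| d_perm : forall X z z' G B,
    Permutation z z' ->
    derivable (plug X (z, G)) B ->
    derivable (plug X (z', G)) B.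

Definition derivable_seq (s : sequent) : Prop := derivable (fst s) (snd s).

Definition cpair (a b : nat) : nat := (a + b) * (a + b + 1) / 2 + b.

Fixpoint enc_formula (A : formula) : nat :=
  match A with
  | Var n => cpair 0 n
  | One => cpair 1 0
  | Under A C => cpair 2 (cpair (enc_formula A) (enc_formula C))
  | Over C B => cpair 3 (cpair (enc_formula C) (enc_formula B))
  | Prod A B => cpair 4 (cpair (enc_formula A) (enc_formula B))
  | Dia A => cpair 5 (enc_formula A)
  | BoxInv A => cpair 6 (enc_formula A)
  | Bang A => cpair 7 (enc_formula A)
  end.

Fixpoint enc_list {T} (e : T -> nat) (l : list T) : nat :=
  match l with
  | [] => 0
  | x :: l' => S (cpair (e x) (enc_list e l'))
  end.

Definition enc_stoup (z : stoup) : nat := enc_list enc_formula z.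

Fixpoint enc_tree (t : tree) : nat :=
  match t with
  | TF A => cpair 0 (enc_formula A)
  | TB z G =>
      cpair 1 (cpair (enc_stoup z)
        ((fix encG (G : list tree) : nat :=
            match G with
            | [] => 0
            | t :: G' => S (cpair (enc_tree t) (encG G'))
            end) G))
  end.

Definition enc_meta (M : meta) : nat :=
  cpair (enc_stoup (fst M)) (enc_list enc_tree (snd M)).

Definition enc_sequent (s : sequent) : nat :=
  cpair (enc_meta (fst s)) (enc_formula (snd s)).

Inductive recfun : Type :=
| RZero : recfun
| RSucc : recfun
| RProj : nat -> recfun
| RComp : recfun -> list recfun -> recfun
| RPrim : recfun -> recfun -> recfun
| RMu   : recfun -> recfun.

Inductive reval : recfun -> list nat -> nat -> Prop :=
| re_zero : forall v, reval RZero v 0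
| re_succ : forall x v, reval RSucc (x :: v) (S x)
| re_proj : forall i v, i < length v -> reval (RProj i) v (nth i v 0)
| re_comp : forall f gs v ws y,
    Forall2 (fun g w => reval g v w) gs ws ->
    reval f ws y -> reval (RComp f gs) v y
| re_prim0 : forall f g v y,
    reval f v y -> reval (RPrim f g) (0 :: v) y
| re_primS : forall f g n v z y,
    reval (RPrim f g) (n :: v) z ->
    reval g (n :: z :: v) y ->
    reval (RPrim f g) (S n :: v) y
| re_mu : forall f v n,
    reval f (n :: v) 0 ->
    (forall m, m < n -> exists k, reval f (m :: v) (S k)) ->
    reval (RMu f) v n.

Definition decidable_sequent_problem (P : sequent -> Prop) : Prop :=
  exists f : recfun, forall s : sequent,
    (P s -> reval f [enc_sequent s] 0) /\
    (~ P s -> reval f [enc_sequent s] 1).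

(* Main.v *)
Require Import Defs.
From Stdlib Require Import List Arith Lia Permutation Relations Cantor FunctionalExtensionality.
Import ListNotations.

(** A semi-Thue rule [u -> v] is the formula [[]^-1 (v / u)], where words stand
    for products of variables: (!C) copies it from the stoup into a new empty
    bracket at any place, and ([]^-1 L) then removes the bracket. Conversely,
    phase semantics over words with brackets erased shows that derivability
    implies rewriting to the empty word. The letters of the semi-Thue system are
    commands of a register language; reading a word as the composition of its
    commands, every rule is an inclusion of relations, so no invariant on the
    rewriting steps is needed. Recursive functions compile to commands. If [f]
    decided derivability, let [c] compute [f] on the code of the sequent for
    input [k] and block on the value [0]; the fixed part [L] of the antecedent
    contains [c] and its rules, and the input [k := enc_list enc_tree L] makes
    [c] ask about the very sequent that describes its run. *)

(** * Rewriting and the calculus *)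

Inductive step {A} (R : list (list A * list A)) : list A -> list A -> Prop :=
| step_intro : forall p q u v,
    In (u, v) R -> step R (p ++ u ++ q) (p ++ v ++ q).

Definition rew {A} (R : list (list A * list A)) := clos_refl_trans_1n _ (step R).

Lemma rew_trans {A} (R : list (list A * list A)) u v w :
  rew R u v -> rew R v w -> rew R u w.
Proof.
  unfold rew; intros Huv Hvw.
  apply clos_rt_rt1n; apply rt_trans with v; now apply clos_rt1n_rt.
Qed.

Lemma rew_rule {A} (R : list (list A * list A)) p q u v :
  In (u, v) R -> rew R (p ++ u ++ q) (p ++ v ++ q).
Proof.
  intros H. eapply Relation_Operators.rt1n_trans; [exact (step_intro R p q u v H) | apply rt1n_refl].
Qed.

Definition map_rules {A B} (f : A -> B) : list (list A * list A) -> list (list B * list B) :=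
  map (fun r => (map f (fst r), map f (snd r))).

Lemma rew_map {A B} (f : A -> B) R u v :
  rew R u v -> rew (map_rules f R) (map f u) (map f v).
Proof.
  induction 1 as [u | u v w [p q x y Hxy] _ IH]; [apply rt1n_refl |].
  eapply rew_trans; [| exact IH]. rewrite !map_app. apply rew_rule.
  exact (in_map (fun r => (map f (fst r), map f (snd r))) _ _ Hxy).
Qed.

Lemma map_injective {A B} (f : A -> B) :
  (forall x y, f x = f y -> x = y) -> forall u v, map f u = map f v -> u = v.
Proof.
  intros Hf; induction u as [| a u IH]; intros [| b v]; simpl; intros E;
    try discriminate; auto.
  injection E as E1 E2. f_equal; auto.
Qed.

(** A factorisation of [map f u] pulls back to one of [u], and injectivity identifies the middle
    factor with the left side of the original rule; so every step lifts. *)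
Lemma rew_map_inv {A B} (f : A -> B) :
  (forall x y, f x = f y -> x = y) ->
  forall R u v, rew (map_rules f R) (map f u) (map f v) -> rew R u v.
Proof.
  intros Hf R u v H.
  remember (map f u) as u' eqn:Eu; remember (map f v) as v' eqn:Ev.
  revert u Eu; induction H as [w | u' m v' S _ IH]; intros u Eu; subst.
  - apply map_injective in Eu; [subst; apply rt1n_refl | exact Hf].
  - inversion S as [p q x y Hxy E1 E2].
    unfold map_rules in Hxy. apply in_map_iff in Hxy as [[a b] [E Hab]].
    simpl in E; injection E as <- <-.
    symmetry in E1. apply map_eq_app in E1 as (p' & r & -> & <- & E1).
    apply map_eq_app in E1 as (a' & q' & -> & E1 & <-).
    apply map_injective in E1; [subst a' | exact Hf].
    eapply rew_trans; [exact (rew_rule _ p' q' _ _ Hab) |].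
    apply IH; [reflexivity | now rewrite !map_app in *].
Qed.

(** * Phase semantics over words *)

Section Phase.

Variable bot : list nat -> Prop.

(** The biorthogonal closure with respect to [bot], where the tests are two-sided contexts because
    concatenation is not commutative. *)
Definition cl (X : list nat -> Prop) : list nat -> Prop :=
  fun w => forall p q, (forall x, X x -> bot (p ++ x ++ q)) -> bot (p ++ w ++ q).

Lemma cl_in (X : list nat -> Prop) w : X w -> cl X w.
Proof. intros H p q Hx; auto. Qed.

(** The surrounding words [p] and [q] can be absorbed into the testing context. This makes [cl]
    compatible with concatenation. *)
Lemma cl_context (X Y : list nat -> Prop) p q w :
  (forall x, X x -> Y (p ++ x ++ q)) -> cl X w -> cl Y (p ++ w ++ q).
Proof.
  intros HXY Hw p' q' H.
  replace (p' ++ (p ++ w ++ q) ++ q') with ((p' ++ p) ++ w ++ (q ++ q'))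
    by now rewrite !app_assoc.
  apply Hw; intros x Hx.
  replace ((p' ++ p) ++ x ++ q ++ q') with (p' ++ (p ++ x ++ q) ++ q')
    by now rewrite !app_assoc.
  apply H, HXY, Hx.
Qed.

(* Brackets are erased, and [!A] keeps only the empty word of [A]. *)
Fixpoint sem (A : formula) : list nat -> Prop :=
  match A with
  | Var n => cl (eq [n])
  | One => cl (eq [])
  | Under A C => fun w => forall x, sem A x -> sem C (x ++ w)
  | Over C B => fun w => forall x, sem B x -> sem C (w ++ x)
  | Prod A B => cl (fun w => exists x y, w = x ++ y /\ sem A x /\ sem B y)
  | Dia A => sem A
  | BoxInv A => sem A
  | Bang A => cl (fun w => w = [] /\ sem A [])
  end.

Lemma cl_idem (X : list nat -> Prop) w : cl (cl X) w -> cl X w.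
Proof. intros H p q Hx. apply H; intros x Hc. now apply Hc. Qed.

(** Residuals of closed sets are closed, since the argument [x] joins the testing context. The other
    connectives are closures by definition or inherit closedness. *)
Lemma sem_closed A w : cl (sem A) w -> sem A w.
Proof.
  revert w; induction A; simpl; intros w H; auto using cl_idem.
  - intros x Hx. apply IHA2. rewrite <- (app_nil_r w).
    apply cl_context with (2 := H). intros y Hy. rewrite app_nil_r; auto.
  - intros x Hx. apply IHA1.
    apply (cl_context _ _ [] x) with (2 := H). intros y Hy. simpl; auto.
Qed.

(** Stoup formulae contribute no letters, so each has to hold at the empty word. Order and
    multiplicity do not matter to this condition, which is what makes (!C) and permutation sound. *)
Definition semz (z : stoup) : Prop := Forall (fun A => sem A []) z.

(** The inner [fix] is a copy of [seml] below; it is inlined because [tree] recurs through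
    [list]. *)
Fixpoint semt (t : tree) : list nat -> Prop :=
  match t with
  | TF A => sem A
  | TB z G => fun w => semz z /\
      (fix seml (G : list tree) (w : list nat) : Prop :=
         match G with
         | [] => w = []
         | t :: G' => exists x y, w = x ++ y /\ semt t x /\ seml G' y
         end) G w
  end.

Fixpoint seml (G : list tree) (w : list nat) : Prop :=
  match G with
  | [] => w = []
  | t :: G' => exists x y, w = x ++ y /\ semt t x /\ seml G' y
  end.

Definition semM (T : meta) (w : list nat) : Prop := semz (fst T) /\ seml (snd T) w.

Lemma seml_app G1 G2 w :
  seml (G1 ++ G2) w <-> exists x y, w = x ++ y /\ seml G1 x /\ seml G2 y.
Proof.
  revert w; induction G1 as [| t G1 IH]; simpl; intros w.
  - split; [intros H; exists [], w; auto | intros (x & y & -> & -> & H); auto].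
  - split.
    + intros (x & y & -> & Ht & H). apply IH in H as (y1 & y2 & -> & H1 & H2).
      exists (x ++ y1), y2. rewrite app_assoc. repeat split; auto.
      exists x, y1; auto.
    + intros (x & y & -> & (x1 & x2 & -> & Ht & H1) & H2).
      exists x1, (x2 ++ y). rewrite app_assoc. repeat split; auto.
      apply IH. exists x2, y; auto.
Qed.

Lemma seml_sing t w : seml [t] w <-> semt t w.
Proof.
  simpl; split.
  - intros (x & y & -> & H & ->). now rewrite app_nil_r.
  - intros H; exists w, []; now rewrite app_nil_r.
Qed.

Lemma seml_cons t G w :
  seml (t :: G) w <-> exists x y, w = x ++ y /\ semt t x /\ seml G y.
Proof. reflexivity. Qed.

(** The tool for all left rules. The meaning of a meta-formula need not be closed, but that of the
    succedent is, so the local replacement only has to be valid up to closure. *)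
Lemma semM_plug X T T' D :
  (forall w, semM T' w -> cl (semM T) w) ->
  (forall w, semM (plug X T) w -> sem D w) ->
  forall w, semM (plug X T') w -> sem D w.
Proof.
  intros HT H w Hw. apply sem_closed.
  assert (Hc : cl (semM (plug X T)) w).
  { clear H; revert w Hw; induction X as [| z G1 X IH G2]; simpl; auto.
    intros w [Hz Hw]; simpl in *.
    apply seml_app in Hw as (p & r & -> & Hp & m & q & -> & Hm & Hq).
    apply (cl_context (semM (plug X T))); [| now apply IH].
    intros x Hx; split; [exact Hz |]; simpl.
    apply seml_app; exists p, (x ++ q); repeat split; auto.
    exists x, q; auto. }
  intros p q Hb. apply Hc. intros x Hx. apply Hb, H, Hx.
Qed.

Lemma semM_plug_list X z D1 G G' D2 D :
  (forall w, semz z -> seml G' w -> cl (seml G) w) ->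
  (forall w, semM (plug X (z, D1 ++ G ++ D2)) w -> sem D w) ->
  forall w, semM (plug X (z, D1 ++ G' ++ D2)) w -> sem D w.
Proof.
  intros HG. apply semM_plug. intros w [Hz Hw]; simpl in *.
  apply seml_app in Hw as (p & r & -> & Hp & Hr).
  apply seml_app in Hr as (m & q & -> & Hm & Hq).
  apply (cl_context (seml G)); [| now apply HG].
  intros x Hx; split; [exact Hz |]; simpl.
  apply seml_app; exists p, (x ++ q); repeat split; auto.
  apply seml_app; exists x, q; auto.
Qed.

(** Bracket rules are immediate because brackets are transparent. In (!C) the new bracket only adds
    a condition on [z2], which the outer stoup already guarantees. *)
Theorem soundness Xi A : derivable Xi A -> forall w, semM Xi w -> sem A w.
Proof.
  induction 1 as
    [A | | X z1 z2 G D1 D2 B C D _ IH1 _ IH2 | z G B C _ IH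
    | X z1 z2 G D1 D2 A C D _ IH1 _ IH2 | z G A C _ IH
    | X z D1 D2 A B D _ IH | z1 z2 D G A B _ IH1 _ IH2 | X z D1 D2 A _ IH
    | X z D1 D2 A B _ IH | Xi A _ IH | X z D1 D2 A B _ IH | Xi A _ IH
    | X z G1 G2 A B _ IH | X z G1 G2 A B _ IH | z B _ IH
    | X z1 z2 G1 G2 G3 B Hne _ IH | X z z' G B HP _ IH].
  - intros w [_ H]. now apply seml_sing in H.
  - intros w [_ H]; simpl in H; subst. now apply cl_in.
  - revert IH2. apply semM_plug. intros w [Hz Hw]; simpl in *.
    apply Forall_app in Hz as [Hz1 Hz2]. apply cl_in; split; [exact Hz2 |]; simpl.
    apply seml_app in Hw as (p & r & -> & Hp & x & r' & -> & Hx & Hr).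
    apply seml_app in Hr as (y & q & -> & Hy & Hq).
    apply seml_app; exists p, (x ++ y ++ q); repeat split; auto.
    exists (x ++ y), q. rewrite app_assoc. repeat split; auto.
    simpl in *. apply Hx, IH1. now split.
  - intros w [Hz Hw] x Hx. apply IH. split; [exact Hz |]; simpl.
    apply seml_app. exists w, x. repeat split; auto. now apply seml_sing.
  - revert IH2. apply semM_plug. intros w [Hz Hw]; simpl in *.
    apply Forall_app in Hz as [Hz1 Hz2]. apply cl_in; split; [exact Hz2 |]; simpl.
    apply seml_app in Hw as (p & r & -> & Hp & Hr).
    apply seml_app in Hr as (y & r' & -> & Hy & x & q & -> & Hx & Hq).
    apply seml_app; exists p, (y ++ x ++ q); repeat split; auto.
    exists (y ++ x), q. rewrite app_assoc. repeat split; auto.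
    simpl in *. apply Hx, IH1. now split.
  - intros w [Hz Hw] x Hx. apply IH. split; [exact Hz |]; simpl.
    exists x, w. repeat split; auto.
  - revert IH. apply (semM_plug_list X z D1 [TF A; TF B] [TF (Prod A B)] D2).
    intros w _ Hw. apply seml_sing in Hw. intros p q Hb. apply Hw.
    intros x (a & b & -> & Ha & Hb'). apply Hb.
    apply seml_cons; exists a, b; repeat split; auto. now apply seml_sing.
  - intros w [Hz Hw]; simpl in *. apply Forall_app in Hz as [Hz1 Hz2].
    apply seml_app in Hw as (x & y & -> & Hx & Hy).
    apply cl_in. exists x, y. repeat split; [apply IH1 | apply IH2]; now split.
  - revert IH. apply (semM_plug_list X z D1 [] [TF One] D2).
    intros w _ Hw. apply seml_sing in Hw. intros p q Hb. apply Hw.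
    intros x <-. now apply Hb.
  - revert IH. apply (semM_plug_list X z D1 [TF A] [TB [] [TF (BoxInv A)]] D2).
    intros w _ Hw. apply seml_sing in Hw as [_ Hw].
    now apply cl_in.
  - intros w Hw. apply IH. split; [constructor |]. now apply seml_sing.
  - revert IH. apply (semM_plug_list X z D1 [TB [] [TF A]] [TF (Dia A)] D2).
    intros w _ Hw. apply cl_in. apply seml_sing. split; [constructor | exact Hw].
  - intros w [_ Hw]. apply IH. now apply seml_sing in Hw.
  - revert IH. apply semM_plug. intros w [Hz Hw]; simpl in *.
    apply seml_app in Hw as (p & r & -> & Hp & x & q & -> & Hx & Hq).
    (* It suffices to treat the generator of [!A], the empty word, and its side condition is exactly
       what the stoup requires of [A]. *)
    revert Hx. apply cl_context. intros y [-> Hy]. split; simpl.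
    + apply Forall_app; split; [exact Hz | now constructor].
    + apply seml_app; exists p, q; auto.
  - revert IH. apply semM_plug. intros w [Hz Hw]; simpl in *.
    apply Forall_app in Hz as [Hz HA]. apply Forall_inv in HA.
    apply cl_in. split; [exact Hz |]; simpl.
    apply seml_app in Hw as (p & q & -> & Hp & Hq).
    apply seml_app. exists p, q. repeat split; auto. exists [], q; auto.
  - intros w [Hz Hw]; simpl in Hw; subst w. apply cl_in. split; [reflexivity |].
    apply IH. now split.
  - revert IH. apply semM_plug. intros w [Hz Hw]; simpl in *.
    apply cl_in. split; [exact Hz |]; simpl.
    apply Forall_app in Hz as [_ Hz2].
    apply seml_app in Hw as (p & r & -> & Hp & Hr).
    apply seml_app in Hr as (m & q & -> & Hm & Hq).
    apply seml_app. exists p, (m ++ q). repeat split; auto. exists m, q.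
    repeat split; auto.
  - revert IH. apply semM_plug. intros w [Hz Hw]; simpl in *.
    apply cl_in. split; [| exact Hw].
    eapply Permutation_Forall; [apply Permutation_sym; exact HP | exact Hz].
Qed.

End Phase.

(** * Semi-Thue rules as formulae *)

Definition word_trees (u : list nat) : list tree := map (fun n => TF (Var n)) u.

Definition word_formula (u : list nat) : formula :=
  fold_right (fun n F => Prod (Var n) F) One u.

Definition rule_formula (r : list nat * list nat) : formula :=
  BoxInv (Over (word_formula (snd r)) (word_formula (fst r))).

(* The formulas [1 / !A] use up the original stoup: there is no weakening. *)
Definition rules_trees (R : list (list nat * list nat)) : list tree :=
  map (fun r => TF (Bang (rule_formula r))) R ++
  map (fun r => TF (Over One (Bang (rule_formula r)))) R.

Lemma sem_word_formula bot u w : sem bot (word_formula u) w <-> cl bot (eq u) w.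
Proof.
  revert w; induction u as [| n u IH]; simpl; intros w; [reflexivity |].
  split; intros H p q Hb; apply H.
  - intros x (a & b & -> & Ha & Hb').
    rewrite <- app_assoc. apply Ha. intros ? <-.
    replace (p ++ [n] ++ b ++ q) with ((p ++ [n]) ++ b ++ q) by now rewrite <- app_assoc.
    apply IH in Hb'. apply Hb'. intros ? <-.
    rewrite <- app_assoc. exact (Hb _ eq_refl).
  - intros x <-. apply Hb. exists [n], u. repeat split; [now apply cl_in |].
    apply IH. now apply cl_in.
Qed.

Lemma seml_empty_words bot G : Forall (fun t => semt bot t []) G -> seml bot G [].
Proof.
  induction 1 as [| t G Ht _ IH]; simpl; [reflexivity |]. exists [], []; auto.
Qed.

(** Let [bot] consist of the words that rewrite to the empty word. Then every formula in
    [rules_trees R] holds at the empty word, and soundness places [u] in the closure of the empty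
    word. *)
Lemma derivable_rew R u :
  derivable ([], word_trees u ++ rules_trees R) One -> rew R u [].
Proof.
  intros H.
  apply (soundness (fun w => rew R w [])) with (w := u) in H.
  (* Testing with the empty context turns membership in the closure into [bot u]. *)
  - specialize (H [] []). simpl in H. rewrite app_nil_r in H.
    apply H. intros x <-. apply rt1n_refl.
  - split; simpl; [constructor |]. apply seml_app. exists u, [].
    rewrite app_nil_r. repeat split.
    + clear H. induction u as [| n u IH]; simpl; [reflexivity |].
      exists [n], u. repeat split; auto. now apply cl_in.
    (* If [p ++ y ++ q] rewrites to the empty word, then so does [p ++ x ++ q], by applying the rule
       first. *)
    + assert (HB : forall r, In r R ->
        sem (fun w => rew R w []) (rule_formula r) []).
      { intros [x y] Hr w Hw. simpl in *. apply sem_word_formula in Hw.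
        apply sem_word_formula. intros p q Hb. apply Hw. intros ? <-.
        eapply rew_trans; [apply rew_rule, Hr | now apply Hb]. }
      apply seml_empty_words, Forall_app; split; apply Forall_map, Forall_forall;
        intros r Hr; simpl.
      * apply cl_in. exact (conj eq_refl (HB r Hr)).
      * intros x Hx p q Hb. apply Hx. intros y [-> _]. now apply Hb.
Qed.

Lemma word_formula_R u : derivable ([], word_trees u) (word_formula u).
Proof.
  induction u as [| n u IH]; simpl; [constructor |].
  exact (d_prodR [] [] [TF (Var n)] _ _ _ (d_ax _) IH).
Qed.

Lemma word_formula_L X z D1 D2 v B :
  derivable (plug X (z, D1 ++ word_trees v ++ D2)) B ->
  derivable (plug X (z, D1 ++ TF (word_formula v) :: D2)) B.
Proof.
  revert D1; induction v as [| n v IH]; simpl; intros D1 H.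
  - now apply d_oneL.
  - apply d_prodL.
    replace (D1 ++ TF (Var n) :: TF (word_formula v) :: D2)
      with ((D1 ++ [TF (Var n)]) ++ TF (word_formula v) :: D2)
      by now rewrite <- app_assoc.
    apply IH. rewrite <- app_assoc. exact H.
Qed.

(** Read upwards: (!C) opens an empty bracket with a copy of the formula in its stoup, (!P) moves
    the copy into the bracket, and the bracket cancels against the modality. The outer stoup is left
    intact, so the rule stays available. *)
Lemma stoup_insert z F G1 G2 B :
  In (BoxInv F) z ->
  derivable (z, G1 ++ TF F :: G2) B -> derivable (z, G1 ++ G2) B.
Proof.
  intros Hin H. apply in_split in Hin as (l1 & l2 & ->).
  (* (!C) duplicates a final segment of the list, so the formula is first moved to the end. *)
  assert (HP : Permutation ((l1 ++ l2) ++ [BoxInv F]) (l1 ++ BoxInv F :: l2)).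
  { rewrite <- app_assoc. apply Permutation_app_head, Permutation_sym, Permutation_cons_append. }
  apply (d_perm Hole _ _ _ _ HP).
  apply (d_bangC Hole (l1 ++ l2) [BoxInv F] G1 [] G2); [discriminate |].
  apply (d_bangP (InBr ((l1 ++ l2) ++ [BoxInv F]) G1 Hole G2) [] [] []). simpl.
  apply (d_boxinvL Hole).
  exact (d_perm Hole _ _ _ _ (Permutation_sym HP) H).
Qed.

Lemma rules_stoup R z G1 G2 B :
  derivable (z ++ map rule_formula R, G1 ++ G2) B ->
  derivable (z, G1 ++ map (fun r => TF (Bang (rule_formula r))) R ++ G2) B.
Proof.
  revert z; induction R as [| r R IH]; simpl; intros z H.
  - now rewrite app_nil_r in H.
  - apply (d_bangL Hole). apply IH. now rewrite <- app_assoc.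
Qed.

(** Each [1 / !A] takes one [A] from the stoup to prove [!A], and leaves a unit that is erased. At
    the end the stoup is empty, as the axiom for the unit demands. *)
Lemma consume_stoup R :
  derivable (map rule_formula R,
             map (fun r => TF (Over One (Bang (rule_formula r)))) R) One.
Proof.
  induction R as [| r R IH]; simpl; [constructor |].
  apply (d_overL Hole [rule_formula r] _ [] []).
  - apply d_bangR, (d_bangP Hole [] [] []), d_ax.
  - simpl. apply (d_oneL Hole _ []). exact IH.
Qed.

(** One rewriting step inserts [v / u] just before the occurrence of [u], consumes that occurrence
    by (/L), and unfolds the product for [v]. *)
Lemma rew_derivable R u :
  rew R u [] -> derivable ([], word_trees u ++ rules_trees R) One.
Proof.
  intros H. unfold rules_trees.
  apply rules_stoup.
  remember [] as e eqn:E in H.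
  simpl. induction H as [w | u v w [p q x y Hxy] _ IH]; subst.
  - apply consume_stoup.
  - unfold word_trees; rewrite !map_app, <- !app_assoc.
    eapply stoup_insert. { exact (in_map rule_formula _ _ Hxy). }
    apply (d_overL Hole [] _ (word_trees x)); [apply word_formula_R |].
    apply (word_formula_L Hole).
    specialize (IH eq_refl).
    unfold word_trees in *; rewrite !map_app, <- !app_assoc in IH. exact IH.
Qed.

(** * A register language as a semi-Thue system *)

(** A word has the state on the left and the pending commands on the right. [Tst], [Reset] and [Any]
    are not allowed in programs: [Reset] marks the left end, [Tst] arises when a loop exits, and
    [Any] finally erases an arbitrary state. *)
Inductive cmd : Type :=
| Inc (r : nat) | Dec (r : nat) | Tst (r : nat) | Skip
| Seq (c1 c2 : cmd) | Loop (r : nat) (c : cmd) | Reset | Any.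

Fixpoint code (c : cmd) : nat :=
  match c with
  | Inc r => to_nat (0, r)
  | Dec r => to_nat (1, r)
  | Tst r => to_nat (2, r)
  | Skip => to_nat (3, 0)
  | Seq c1 c2 => to_nat (4, to_nat (code c1, code c2))
  | Loop r c => to_nat (5, to_nat (r, code c))
  | Reset => to_nat (6, 0)
  | Any => to_nat (7, 0)
  end.

Lemma to_nat_injective p q : to_nat p = to_nat q -> p = q.
Proof.
  intros H. rewrite <- (cancel_of_to p), <- (cancel_of_to q). now rewrite H.
Qed.

Lemma code_injective c d : code c = code d -> c = d.
Proof.
  revert d; induction c; intros []; cbn [code]; intros E;
    apply to_nat_injective, pair_equal_spec in E as [E0 E]; try discriminate E0;
    try (now subst); apply to_nat_injective, pair_equal_spec in E as [E1 E2];
    f_equal; auto.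
Qed.

Definition state := nat -> nat.

Definition upd (s : state) (r x : nat) : state :=
  fun i => if Nat.eq_dec i r then x else s i.

Ltac upd_ext := let j := fresh "j" in extensionality j; unfold upd;
  repeat match goal with |- context [Nat.eq_dec ?a ?b] => destruct (Nat.eq_dec a b) end;
  subst; auto; try lia.

Lemma upd_same s r x : upd s r x r = x.
Proof. unfold upd. now destruct (Nat.eq_dec r r). Qed.

Lemma upd_other s r x i : i <> r -> upd s r x i = s i.
Proof. unfold upd. now destruct (Nat.eq_dec i r). Qed.

Lemma upd_id s r x : s r = x -> upd s r x = s.
Proof. intros <-; upd_ext. Qed.

(* [Loop r c] is [while r > 0 { r := r - 1; c }]; [Dec] and [Tst] block when
   their test fails. *)
Inductive exec : cmd -> state -> state -> Prop :=
| ex_inc r s : exec (Inc r) s (upd s r (S (s r)))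
| ex_dec r s m : s r = S m -> exec (Dec r) s (upd s r m)
| ex_tst r s : s r = 0 -> exec (Tst r) s s
| ex_skip s : exec Skip s s
| ex_seq c1 c2 s t u : exec c1 s t -> exec c2 t u -> exec (Seq c1 c2) s u
| ex_loop0 r c s : s r = 0 -> exec (Loop r c) s s
| ex_loopS r c s m t u :
    s r = S m -> exec c (upd s r m) t -> exec (Loop r c) t u -> exec (Loop r c) s u
| ex_reset s : exec Reset s (fun _ => 0)
| ex_any s t : exec Any s t.

Fixpoint run (w : list cmd) (s t : state) : Prop :=
  match w with
  | [] => s = t
  | c :: w' => exists u, exec c s u /\ run w' u t
  end.

Lemma run_app w1 w2 s t : run (w1 ++ w2) s t <-> exists u, run w1 s u /\ run w2 u t.
Proof.
  revert s; induction w1 as [| c w1 IH]; simpl; intros s.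
  - split; [intros H; exists s; auto | intros (u & -> & H); auto].
  - split.
    + intros (v & Hc & H). apply IH in H as (u & H1 & H2). exists u; split; auto.
      exists v; auto.
    + intros (u & (v & Hc & H1) & H2). exists v; split; auto. apply IH. exists u; auto.
Qed.

(** [Dec r] travels left through the increments until it cancels one of register [r]. The bound [N]
    on registers keeps the system finite. *)
Definition dec_rules (N r : nat) : list (list cmd * list cmd) :=
  ([Inc r; Dec r], []) :: map (fun s => ([Inc s; Dec r], [Dec r; Inc s])) (seq 0 N).

(** [Tst r] travels left past increments of other registers only, so it reaches [Reset] only if
    register [r] is zero. *)
Definition tst_rules (N r : nat) : list (list cmd * list cmd) :=
  ([Reset; Tst r], [Reset]) ::
  map (fun s => ([Inc s; Tst r], [Tst r; Inc s]))
      (filter (fun s => negb (s =? r)) (seq 0 N)).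

(* A state is written [Reset] followed by increments in any order. A rule
   [(u, v)] rewrites [u] to [v], and every run of [v] is a run of [u]. *)
Fixpoint rules (N : nat) (c : cmd) : list (list cmd * list cmd) :=
  match c with
  | Inc _ | Reset => []
  | Dec r => dec_rules N r
  | Tst r => tst_rules N r
  | Skip => [([Skip], [])]
  | Seq c1 c2 => ([Seq c1 c2], [c1; c2]) :: rules N c1 ++ rules N c2
  | Loop r c1 =>
      ([Loop r c1], [Tst r]) :: ([Loop r c1], [Dec r; c1; Loop r c1]) ::
      dec_rules N r ++ tst_rules N r ++ rules N c1
  | Any => ([Reset; Any], []) :: map (fun s => ([Inc s; Any], [Any])) (seq 0 N)
  end.

Definition rule_sound (r : list cmd * list cmd) : Prop :=
  forall s t, run (snd r) s t -> run (fst r) s t.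

(** In the case [s = r] the inclusion is strict: from a state with register [r] zero,
    increment-then-decrement runs but the reverse order blocks. *)
Lemma dec_rules_sound N r : Forall rule_sound (dec_rules N r).
Proof.
  constructor.
  - intros s t <-. exists (upd s r (S (s r))); split; [constructor |].
    exists s; split; [| reflexivity].
    pose proof (ex_dec r _ _ (upd_same s r (S (s r)))) as H.
    now replace (upd (upd s r (S (s r))) r (s r)) with s in H by upd_ext.
  - apply Forall_map, Forall_forall; intros i _ s t (u & H1 & v & H2 & <-).
    inversion H1 as [| ? ? m E | | | | | | |]; inversion H2; subst.
    exists (upd s i (S (s i))); split; [constructor |].
    exists (upd (upd s r m) i (S (upd s r m i))); split; [| reflexivity].
    destruct (Nat.eq_dec i r) as [-> | Hi].
    + replace (upd (upd s r m) r (S (upd s r m r)))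
        with (upd (upd s r (S (s r))) r (S m)) by (rewrite upd_same; upd_ext).
      constructor. rewrite upd_same; lia.
    + rewrite (upd_other _ _ _ _ Hi).
      replace (upd (upd s r m) i (S (s i))) with (upd (upd s i (S (s i))) r m) by upd_ext.
      constructor. rewrite upd_other; auto.
Qed.

Lemma tst_rules_sound N r : Forall rule_sound (tst_rules N r).
Proof.
  constructor.
  - intros s t (u & H1 & <-). exists u; split; [exact H1 |].
    inversion H1; subst. eexists; split; [now constructor | reflexivity].
  - apply Forall_map, Forall_forall; intros i Hi s t (u & H1 & v & H2 & <-).
    apply filter_In in Hi as [_ Hi].
    assert (Hn : i <> r) by (destruct (Nat.eqb_spec i r); [discriminate Hi | assumption]).
    inversion H1; inversion H2; subst.
    exists (upd u i (S (u i))); split; [constructor |].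
    exists (upd u i (S (u i))); split; [| reflexivity].
    constructor. rewrite upd_other; auto.
Qed.

Lemma rules_sound N c : Forall rule_sound (rules N c).
Proof.
  induction c; cbn [rules];
    repeat first [apply dec_rules_sound | apply tst_rules_sound | assumption
      | apply Forall_app; split | apply Forall_nil | apply Forall_cons
      | apply Forall_map, Forall_forall; intros i _].
  - intros s t <-. exists s; split; [constructor | reflexivity].
  - intros s t (u & H1 & v & H2 & <-). exists v; split; [| reflexivity].
    now apply ex_seq with u.
  - intros s t (u & H1 & <-). inversion H1; subst.
    exists u; split; [now constructor | reflexivity].
  - intros s t (u & H1 & v & H2 & x & H3 & <-). inversion H1; subst.
    exists x; split; [eapply ex_loopS; eauto | reflexivity].
  - intros s t <-. exists (fun _ => 0); split; [constructor |].
    exists s; split; [constructor | reflexivity].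
  - intros s t (u & H & <-). eexists; split; [constructor |].
    exists u; split; [constructor | reflexivity].
Qed.

(** Composition of relations is monotone, so the inclusions given by the rules extend to contexts
    and accumulate along a rewriting. *)
Lemma rew_run R u v s t :
  Forall rule_sound R -> rew R u v -> run v s t -> run u s t.
Proof.
  intros HR H; induction H as [| u v w [p q x y Hxy] _ IH]; auto.
  intros Hw; specialize (IH Hw).
  apply run_app in IH as (a & Ha & IH). apply run_app in IH as (b & Hb & Hq).
  apply run_app; exists a; split; auto. apply run_app; exists b; split; auto.
  rewrite Forall_forall in HR. exact (HR _ Hxy _ _ Hb).
Qed.

Fixpoint wf (N : nat) (c : cmd) : Prop :=
  match c with
  | Inc r | Dec r => r < N
  | Skip => True
  | Seq c1 c2 => wf N c1 /\ wf N c2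
  | Loop r c => r < N /\ wf N c
  | Tst _ | Reset | Any => False
  end.

Fixpoint program (c : cmd) : Prop :=
  match c with
  | Inc _ | Dec _ | Skip => True
  | Seq c1 c2 => program c1 /\ program c2
  | Loop _ c => program c
  | Tst _ | Reset | Any => False
  end.

Lemma wf_mono N M c : N <= M -> wf N c -> wf M c.
Proof. intros H; induction c; simpl; try tauto; lia || (intros []; split; auto; lia). Qed.

Lemma program_wf c : program c -> exists N, wf N c.
Proof.
  induction c; simpl; intros H; try contradiction.
  - exists (S r); lia.
  - exists (S r); lia.
  - now exists 0.
  - destruct H as [H1 H2].
    destruct (IHc1 H1) as [N1 W1], (IHc2 H2) as [N2 W2].
    exists (max N1 N2); split; (eapply wf_mono; [| eassumption]); lia.
  - destruct (IHc H) as [N W]. exists (max (S r) N); split; [lia |].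
    eapply wf_mono; [| exact W]; lia.
Qed.

(** The state represented by the word [Reset :: map Inc l]. *)
Definition count (l : list nat) : state := count_occ Nat.eq_dec l.

Lemma count_app l1 l2 i : count (l1 ++ l2) i = count l1 i + count l2 i.
Proof. apply count_occ_app. Qed.

(** * Executions as rewriting sequences *)

Section Complete.

Variables (N : nat) (R : list (list cmd * list cmd)).

Let bounded (l : list nat) := Forall (fun i => i < N) l.

(** The command meets the increments from the right, hence the induction on [l] from its end.
    Further occurrences of [r] in [l] are passed as well, so any chosen occurrence can be
    cancelled. *)
Lemma rew_dec r l p q :
  incl (dec_rules N r) R -> bounded l ->
  rew R (p ++ map Inc (r :: l) ++ Dec r :: q) (p ++ map Inc l ++ q).
Proof.
  intros HR Hl. revert q; induction l as [| i l IH] using rev_ind; intros q.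
  - apply (rew_rule R p q [Inc r; Dec r] []). apply HR. now left.
  - apply Forall_app in Hl as [Hl Hi]. apply Forall_inv in Hi.
    specialize (IH Hl (Inc i :: q)).
    simpl. rewrite map_app, <- !app_assoc. simpl in *.
    eapply rew_trans; [| exact IH].
    replace (p ++ Inc r :: map Inc l ++ Inc i :: Dec r :: q)
      with ((p ++ Inc r :: map Inc l) ++ [Inc i; Dec r] ++ q)
      by now rewrite <- !app_assoc.
    replace (p ++ Inc r :: map Inc l ++ Dec r :: Inc i :: q)
      with ((p ++ Inc r :: map Inc l) ++ [Dec r; Inc i] ++ q)
      by now rewrite <- !app_assoc.
    apply rew_rule, HR. right.
    apply (in_map (fun s => ([Inc s; Dec r], [Dec r; Inc s]))), in_seq; lia.
Qed.

Lemma rew_tst r l q :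
  incl (tst_rules N r) R -> bounded l -> count l r = 0 ->
  rew R (Reset :: map Inc l ++ Tst r :: q) (Reset :: map Inc l ++ q).
Proof.
  intros HR Hl. revert q; induction l as [| i l IH] using rev_ind; intros q Hc.
  - apply (rew_rule R [] q [Reset; Tst r] [Reset]). apply HR. now left.
  - apply Forall_app in Hl as [Hl Hi]. apply Forall_inv in Hi.
    rewrite count_app in Hc.
    assert (Hir : i <> r).
    { intros ->. cbn in Hc. destruct (Nat.eq_dec r r); [lia | easy]. }
    specialize (IH Hl (Inc i :: q)).
    rewrite map_app, <- !app_assoc. simpl in *.
    eapply rew_trans; [| apply IH; lia].
    apply (rew_rule R (Reset :: map Inc l) q [Inc i; Tst r] [Tst r; Inc i]).
    apply HR. right.
    apply (in_map (fun s => ([Inc s; Tst r], [Tst r; Inc s]))), filter_In.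
    split; [apply in_seq; lia |]. now apply Nat.eqb_neq in Hir as ->.
Qed.

Lemma rew_any l : incl (rules N Any) R -> bounded l ->
  rew R (Reset :: map Inc l ++ [Any]) [].
Proof.
  intros HR Hl. induction l as [| i l IH] using rev_ind.
  - apply (rew_rule R [] [] [Reset; Any] []). apply HR. now left.
  - apply Forall_app in Hl as [Hl Hi]. apply Forall_inv in Hi.
    rewrite map_app, <- app_assoc.
    eapply rew_trans; [| exact (IH Hl)].
    apply (rew_rule R (Reset :: map Inc l) [] [Inc i; Any] [Any]).
    apply HR. right.
    apply (in_map (fun s => ([Inc s; Any], [Any]))), in_seq; lia.
Qed.

Lemma count_dec l r m : count l r = S m ->
  exists l1 l2, l = l1 ++ r :: l2 /\ count (l1 ++ l2) = upd (count l) r m.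
Proof.
  intros Hc.
  assert (Hin : In r l) by (apply (count_occ_In Nat.eq_dec); unfold count in Hc; lia).
  apply in_split in Hin as (l1 & l2 & ->). exists l1, l2; split; auto.
  rewrite count_app in Hc. unfold count in Hc; simpl in Hc.
  destruct (Nat.eq_dec r r); [| easy].
  extensionality i. rewrite count_app. unfold upd, count.
  rewrite count_occ_app. simpl.
  destruct (Nat.eq_dec i r), (Nat.eq_dec r i); subst; try easy; lia.
Qed.

(** The list [l'] is existential because a state does not fix the order of its increments. The
    arbitrary [q] holds the commands still to be executed, which lets sequences and loops be
    chained. *)
Lemma exec_rew c s t :
  exec c s t -> wf N c -> incl (rules N c) R ->
  forall l, bounded l -> count l = s ->
  exists l', bounded l' /\ count l' = t /\
    forall q, rew R (Reset :: map Inc l ++ c :: q) (Reset :: map Inc l' ++ q).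
Proof.
  induction 1 as [r s | r s m E | | s | c1 c2 s t u _ IH1 _ IH2 | r c s E
    | r c s m t u E _ IH1 _ IH2 | |]; cbn [rules wf]; intros HW HR l Hl Hc; try contradiction.
  - exists (l ++ [r]). repeat split.
    + apply Forall_app; split; auto.
    + subst s. extensionality i. rewrite count_app. unfold upd, count. simpl.
      destruct (Nat.eq_dec i r), (Nat.eq_dec r i); subst; try easy; lia.
    + intros q. rewrite map_app, <- app_assoc. apply rt1n_refl.
  - subst s. destruct (count_dec _ _ _ E) as (l1 & l2 & El & Ec). subst l.
    apply Forall_app in Hl as [H1 H2]. apply Forall_inv_tail in H2.
    exists (l1 ++ l2); repeat split; auto. { now apply Forall_app. }
    intros q. rewrite !map_app, <- !app_assoc.
    now apply (rew_dec r l2 (Reset :: map Inc l1)).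
  - exists l; repeat split; auto. intros q.
    apply (rew_rule R (Reset :: map Inc l) q [Skip] []). apply HR. now left.
  - apply incl_cons_inv in HR as [HR0 HR]. apply incl_app_inv in HR as [HR1 HR2].
    destruct HW as [HW1 HW2].
    destruct (IH1 HW1 HR1 l Hl Hc) as (l1 & Hl1 & Hc1 & Hr1).
    destruct (IH2 HW2 HR2 l1 Hl1 Hc1) as (l2 & Hl2 & Hc2 & Hr2).
    exists l2; repeat split; auto. intros q.
    eapply rew_trans; [exact (rew_rule R (Reset :: map Inc l) q _ _ HR0) |].
    eapply rew_trans; [apply Hr1 | apply Hr2].
  - apply incl_cons_inv in HR as [HR0 HR]. apply incl_cons_inv in HR as [_ HR].
    apply incl_app_inv in HR as [_ HR]. apply incl_app_inv in HR as [HR1 _].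
    exists l; repeat split; auto. intros q.
    eapply rew_trans; [exact (rew_rule R (Reset :: map Inc l) q _ _ HR0) |].
    apply rew_tst; auto. now subst s.
  - specialize (fun H => IH2 HW H).
    destruct HW as [HWr HW]. pose proof HR as HR'.
    apply incl_cons_inv in HR as [_ HR]. apply incl_cons_inv in HR as [HR0 HR].
    apply incl_app_inv in HR as [HRd HR]. apply incl_app_inv in HR as [_ HRc].
    subst s. destruct (count_dec _ _ _ E) as (l1 & l2 & El & Ec).
    assert (H12 : bounded (l1 ++ l2) /\ bounded l2).
    { subst l. apply Forall_app in Hl as [H1 H2]. apply Forall_inv_tail in H2.
      split; auto. now apply Forall_app. }
    destruct H12 as [Hl12 Hl2].
    destruct (IH1 HW HRc _ Hl12 Ec) as (l3 & Hl3 & Hc3 & Hr3).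
    destruct (IH2 HR' _ Hl3 Hc3) as (l4 & Hl4 & Hc4 & Hr4).
    exists l4; repeat split; auto. intros q.
    eapply rew_trans; [exact (rew_rule R (Reset :: map Inc l) q _ _ HR0) |].
    eapply rew_trans; [| eapply rew_trans; [apply Hr3 | apply Hr4]].
    subst l. cbn [app]. rewrite !map_app, <- !app_assoc.
    exact (rew_dec r l2 (Reset :: map Inc l1) _ HRd Hl2).
Qed.

End Complete.

(** The system is chosen before the input [k]; the diagonal argument relies on this order of
    quantifiers. *)
Lemma program_rew c : program c -> exists R, forall k,
  (exists t, exec c (upd (fun _ => 0) 0 k) t) <->
  rew R (Reset :: repeat (Inc 0) k ++ [c; Any]) [].
Proof.
  intros HP. destruct (program_wf c HP) as [N0 HW0].
  (* The successor ensures that the input register [0] is below the bound. *)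
  set (N := S N0). assert (HW : wf N c) by (apply (wf_mono N0); unfold N; auto).
  exists (rules N c ++ rules N Any). intros k. split.
  - intros [t Ht].
    assert (Hrep : map Inc (repeat 0 k) = repeat (Inc 0) k) by apply map_repeat.
    rewrite <- Hrep.
    eapply (exec_rew N) in Ht as (l & Hl & _ & Hr).
    + eapply rew_trans; [apply Hr |]. apply rew_any with N; auto.
      apply incl_appr, incl_refl.
    + exact HW.
    + apply incl_appl, incl_refl.
    + apply Forall_forall. intros x Hx. apply repeat_spec in Hx. unfold N; lia.
    + extensionality i. unfold count, upd.
      destruct (Nat.eq_dec i 0) as [-> | Hi].
      * apply count_occ_repeat_eq; auto.
      * apply count_occ_repeat_neq; auto.
  - intros H.
    assert (Hs : Forall rule_sound (rules N c ++ rules N Any))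
      by (apply Forall_app; split; apply rules_sound).
    (* The empty word runs from any state to itself, so the initial word has a run as well; its
       first letter resets the state to zero. *)
    apply (rew_run _ _ _ (fun _ => 0) (fun _ => 0) Hs) in H; [| reflexivity].
    destruct H as (s & H0 & H). inversion H0; subst.
    apply run_app in H as (s & H1 & t & H2 & _).
    exists t. replace (upd (fun _ => 0) 0 k) with s; [exact H2 |].
    assert (E : forall k u v, run (repeat (Inc 0) k) u v -> v = upd u 0 (k + u 0)).
    { clear. induction k as [| k IH]; simpl; intros u v H.
      - subst; symmetry; now apply upd_id.
      - destruct H as (w & Hw & H). inversion Hw; subst. apply IH in H. subst.
        rewrite upd_same. upd_ext. }
    apply E in H1. rewrite Nat.add_0_r in H1. exact H1.
Qed.

(** * Compilation of recursive functions *)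

Lemma exec_inc r s t : exec (Inc r) s t <-> t = upd s r (S (s r)).
Proof.
  split; [intros H; inversion H; now subst | intros ->; constructor].
Qed.

Lemma exec_dec0 r s t : s r = 0 -> ~ exec (Dec r) s t.
Proof. intros E H; inversion H; congruence. Qed.

Lemma exec_skip s t : exec Skip s t <-> t = s.
Proof.
  split; [intros H; inversion H; now subst | intros ->; constructor].
Qed.

Lemma exec_seq c d s t : exec (Seq c d) s t <-> exists u, exec c s u /\ exec d u t.
Proof.
  split; [intros H; inversion H; subst; eauto | intros (u & H1 & H2); econstructor; eauto].
Qed.

Lemma exec_loop r c s t : exec (Loop r c) s t <->
  (s r = 0 /\ t = s) \/
  exists m u, s r = S m /\ exec c (upd s r m) u /\ exec (Loop r c) u t.
Proof.
  split.
  - intros H; inversion H; subst; eauto 7.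
  - intros [[H ->] | (m & u & H & Hc & Hl)]; [now constructor | econstructor; eauto].
Qed.

Definition clear (r : nat) : cmd := Loop r Skip.

(** The loop register counts the remaining iterations. Induction on its content with the state left
    general is also the pattern for [move] and [copy]. *)
Lemma exec_clear r s t : exec (clear r) s t <-> t = upd s r 0.
Proof.
  unfold clear. remember (s r) as n eqn:E. revert s E.
  induction n as [| n IH]; intros s E; rewrite exec_loop, <- E.
  - rewrite upd_id by auto. split; auto.
    intros [[_ H] | (? & ? & ? & _)]; [auto | discriminate].
  - split.
    + intros [[? _] | (m & u & Em & Hs & Hl)]; [discriminate |].
      injection Em as <-. apply exec_skip in Hs as ->.
      apply IH in Hl; [subst; upd_ext | now rewrite upd_same].
    + intros ->. right. exists n, (upd s r n). rewrite exec_skip, IH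
        by (now rewrite upd_same). repeat split. upd_ext.
Qed.

Fixpoint clears (l : list nat) : cmd :=
  match l with [] => Skip | r :: l' => Seq (clear r) (clears l') end.

Lemma exec_clears l s t :
  exec (clears l) s t <-> t = fun i => if in_dec Nat.eq_dec i l then 0 else s i.
Proof.
  revert s; induction l as [| r l IH]; intros s; cbn [clears].
  - apply exec_skip.
  - rewrite exec_seq.
    assert (E : (fun i => if in_dec Nat.eq_dec i (r :: l) then 0 else s i) =
                (fun i => if in_dec Nat.eq_dec i l then 0 else upd s r 0 i)).
    { extensionality i. unfold upd.
      destruct (in_dec Nat.eq_dec i (r :: l)) as [[] | Hn],
        (in_dec Nat.eq_dec i l), (Nat.eq_dec i r); subst; auto; try easy;
        exfalso; apply Hn; simpl; auto. }
    rewrite E. split.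
    + intros (u & Hu & H). apply exec_clear in Hu as ->. now apply IH.
    + intros H. exists (upd s r 0). now rewrite exec_clear, IH.
Qed.

Definition move (a d : nat) : cmd := Loop a (Inc d).

Lemma exec_move a d s t : a <> d ->
  exec (move a d) s t <-> t = upd (upd s a 0) d (s d + s a).
Proof.
  intros Had. unfold move. remember (s a) as n eqn:E. revert s E.
  induction n as [| n IH]; intros s E; rewrite exec_loop, <- E.
  - replace (upd (upd s a 0) d (s d + 0)) with s by upd_ext. split; auto.
    intros [[_ H] | (? & ? & ? & _)]; [auto | discriminate].
  - assert (E' : upd (upd (upd (upd s a n) d (S (s d))) a 0) d (S (s d) + n) =
                 upd (upd s a 0) d (s d + S n)) by upd_ext.
    rewrite <- E'. clear E'.
    assert (IH' := IH (upd (upd s a n) d (S (s d)))).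
    rewrite upd_same, (upd_other _ d), upd_same in IH' by auto.
    specialize (IH' eq_refl). rewrite <- IH'. clear IH IH'. split.
    + intros [[? _] | (m & u & Em & Hs & Hl)]; [discriminate |].
      injection Em as <-. apply exec_inc in Hs as ->.
      rewrite (upd_other _ a) in Hl by auto. exact Hl.
    + intros Hl. right. exists n, (upd (upd s a n) d (S (s d))).
      repeat split; auto. rewrite exec_inc, (upd_other _ a); auto.
Qed.

(** Reading a register destroys it, so a second copy is made in [e] to restore [a]. *)
Definition copy (a d e : nat) : cmd := Seq (Loop a (Seq (Inc d) (Inc e))) (move e a).

Lemma exec_copy_loop a d e s t : a <> d -> a <> e -> d <> e ->
  exec (Loop a (Seq (Inc d) (Inc e))) s t <->
  t = upd (upd (upd s a 0) d (s d + s a)) e (s e + s a).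
Proof.
  intros Had Hae Hde. remember (s a) as n eqn:E. revert s E.
  induction n as [| n IH]; intros s E; rewrite exec_loop, <- E.
  - replace (upd (upd (upd s a 0) d (s d + 0)) e (s e + 0)) with s by upd_ext.
    split; auto.
    intros [[_ H] | (? & ? & ? & _)]; [auto | discriminate].
  - assert (Hb : forall u, exec (Seq (Inc d) (Inc e)) (upd s a n) u <->
      u = upd (upd (upd s a n) d (S (s d))) e (S (s e))).
    { intros u. rewrite exec_seq. split.
      - intros (v & H1 & H2). apply exec_inc in H1, H2. subst.
        rewrite !upd_other by auto. reflexivity.
      - intros ->. eexists; split; apply exec_inc; [reflexivity |].
        rewrite !upd_other by auto. reflexivity. }
    set (s1 := upd (upd (upd s a n) d (S (s d))) e (S (s e))) in *.
    assert (E1 : s1 a = n /\ s1 d = S (s d) /\ s1 e = S (s e)).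
    { unfold s1. repeat split; repeat (rewrite upd_same || rewrite upd_other by auto); auto. }
    destruct E1 as (Ea & Ed & Ee).
    assert (E' : upd (upd (upd s a 0) d (s d + S n)) e (s e + S n) =
      upd (upd (upd s1 a 0) d (s1 d + n)) e (s1 e + n)).
    { rewrite Ed, Ee. unfold s1. clear. upd_ext. }
    rewrite E', <- (IH s1) by auto. split.
    + intros [[? _] | (m & u & Em & Hs & Hl)]; [discriminate |].
      injection Em as <-. apply Hb in Hs as ->. exact Hl.
    + intros Hl. right. exists n, s1. rewrite Hb. auto.
Qed.

Lemma exec_copy a d e s t : a <> d -> a <> e -> d <> e -> s d = 0 -> s e = 0 ->
  exec (copy a d e) s t <-> t = upd s d (s a).
Proof.
  intros Had Hae Hde Hd He. unfold copy. rewrite exec_seq.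
  assert (E : upd s d (s a) =
    let u := upd (upd (upd s a 0) d (s d + s a)) e (s e + s a) in
    upd (upd u e 0) a (u a + u e)).
  { cbn zeta. rewrite !upd_same, (upd_other _ e), (upd_other _ d), upd_same by auto.
    rewrite Hd, He. upd_ext. }
  rewrite E. cbn zeta. split.
  - intros (u & H1 & H2). apply exec_copy_loop in H1; auto.
    apply exec_move in H2; auto. now subst.
  - intros ->. eexists; split; [apply exec_copy_loop; auto |].
    apply exec_move; auto.
Qed.

(* [comp g rs o b] reads the arguments of [g] from the registers [rs] and
   writes the value to [o]; registers from [b] on are scratch space, zero
   before and after. A missing argument blocks on [Dec b]. *)
Fixpoint comp (g : recfun) (rs : list nat) (o b : nat) : cmd :=
  match g with
  | RZero => Skip
  | RSucc =>
      match rs with [] => Dec b | a :: _ => Seq (copy a o b) (Inc o) end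
  | RProj i => if i <? length rs then copy (nth i rs 0) o b else Dec b
  | RComp f gs =>
      let m := length gs in
      Seq ((fix comps (gs : list recfun) (j : nat) : cmd :=
              match gs with
              | [] => Skip
              | g :: gs' => Seq (comp g rs j (b + m)) (comps gs' (S j))
              end) gs b)
          (Seq (comp f (seq b m) o (b + m)) (clears (seq b m)))
  | RPrim f g =>
      match rs with
      | [] => Dec b
      | a :: rs' =>
          Seq (copy a b (b + 2)) (Seq (comp f rs' o (b + 3))
            (Seq (Loop b
               (Seq (comp g (b + 1 :: o :: rs') (b + 2) (b + 3))
               (Seq (clear o) (Seq (move (b + 2) o) (Inc (b + 1))))))
            (clear (b + 1))))
      end
  | RMu f =>
      Seq (comp f (o :: rs) b (b + 1))
          (Loop b (Seq (clear b) (Seq (Inc o) (comp f (o :: rs) b (b + 1)))))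
  end.

(** The local [fix] of [comp] under a name, with the scratch base [B] kept fixed while the target
    [j] advances. *)
Fixpoint comps (rs : list nat) (B : nat) (gs : list recfun) (j : nat) : cmd :=
  match gs with
  | [] => Skip
  | g :: gs' => Seq (comp g rs j B) (comps rs B gs' (S j))
  end.

Lemma comp_RComp f gs rs o b : comp (RComp f gs) rs o b =
  Seq (comps rs (b + length gs) gs b)
      (Seq (comp f (seq b (length gs)) o (b + length gs)) (clears (seq b (length gs)))).
Proof.
  cbn [comp]. f_equal. generalize (b + length gs) as B. generalize b as j.
  induction gs as [| g gs IH]; intros j B; cbn [comps]; [reflexivity |].
  now rewrite <- IH.
Qed.

Section recfun_nested_ind.

Variable P : recfun -> Prop.
Hypothesis HZero : P RZero.
Hypothesis HSucc : P RSucc.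
Hypothesis HProj : forall i, P (RProj i).
Hypothesis HComp : forall f gs, P f -> Forall P gs -> P (RComp f gs).
Hypothesis HPrim : forall f g, P f -> P g -> P (RPrim f g).
Hypothesis HMu : forall f, P f -> P (RMu f).

(** The generated induction principle gives no hypothesis for the list inside [RComp]. *)
Fixpoint recfun_nested_ind (g : recfun) : P g :=
  match g with
  | RZero => HZero
  | RSucc => HSucc
  | RProj i => HProj i
  | RComp f gs => HComp f gs (recfun_nested_ind f)
      ((fix all (gs : list recfun) : Forall P gs :=
          match gs with
          | [] => Forall_nil P
          | g :: gs' => Forall_cons g (recfun_nested_ind g) (all gs')
          end) gs)
  | RPrim f g => HPrim f g (recfun_nested_ind f) (recfun_nested_ind g)
  | RMu f => HMu f (recfun_nested_ind f)
  end.

End recfun_nested_ind.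

(** For minimisation, the smaller of two different results would be a zero at which the other
    evaluation requires a successor. *)
Lemma reval_functional g : forall v x y, reval g v x -> reval g v y -> x = y.
Proof.
  induction g as [| | i | f gs IHf IHgs | f g IHf IHg | f IHf] using recfun_nested_ind;
    intros v x y Hx Hy.
  - inversion Hx; inversion Hy; congruence.
  - inversion Hx; inversion Hy; congruence.
  - inversion Hx; inversion Hy; congruence.
  - inversion Hx as [| | | ? ? ? ws ? H1 H2 | | |]; subst.
    inversion Hy as [| | | ? ? ? ws' ? H1' H2' | | |]; subst.
    assert (ws = ws').
    { clear - IHgs H1 H1'. revert ws' H1'.
      induction H1 as [| g w gs ws Hw _ IH]; intros ws' H1'; inversion H1'; subst; auto.
      inversion IHgs; subst. f_equal; eauto. }
    subst; eauto.
  - destruct v as [| n v]; [inversion Hx |].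
    revert x y Hx Hy; induction n as [| n IH]; intros x y Hx Hy.
    + inversion Hx; inversion Hy; subst; eauto.
    + inversion Hx as [| | | | | ? ? ? ? z ? H1 H2 |]; subst.
      inversion Hy as [| | | | | ? ? ? ? z' ? H1' H2' |]; subst.
      assert (z = z') by eauto. subst; eauto.
  - inversion Hx as [| | | | | | ? ? ? H1 H2]; subst.
    inversion Hy as [| | | | | | ? ? ? H1' H2']; subst.
    destruct (Nat.lt_trichotomy x y) as [L | [L | L]]; auto.
    + destruct (H2' _ L) as [k Hk]. specialize (IHf _ _ _ H1 Hk). discriminate.
    + destruct (H2 _ L) as [k Hk]. specialize (IHf _ _ _ H1' Hk). discriminate.
Qed.

(** Primitive recursion as the compiled loop performs it, with index [j] rising and accumulator [z],
    while [reval] unfolds from the top argument downwards. *)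
Fixpoint prim_steps (g : recfun) (v : list nat) (m j z y : nat) : Prop :=
  match m with
  | 0 => y = z
  | S m' => exists x, reval g (j :: z :: v) x /\ prim_steps g v m' (S j) x y
  end.

Lemma prim_steps_last g v m j z y :
  prim_steps g v (S m) j z y <->
  exists x, prim_steps g v m j z x /\ reval g (j + m :: x :: v) y.
Proof.
  revert j z; induction m as [| m IH]; intros j z.
  - simpl. rewrite Nat.add_0_r. split.
    + intros (x & H & ->); eauto.
    + intros (x & -> & H); eauto.
  - change (prim_steps g v (S (S m)) j z y)
      with (exists x, reval g (j :: z :: v) x /\ prim_steps g v (S m) (S j) x y).
    split.
    + intros (x & H & H'). apply IH in H' as (x' & H1 & H2).
      exists x'. rewrite <- Nat.add_succ_comm. split; auto. now exists x.
    + intros (x' & (x & H & H1) & H2). exists x; split; auto.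
      apply IH. exists x'. rewrite Nat.add_succ_comm. auto.
Qed.

Lemma reval_prim f g n v y :
  reval (RPrim f g) (n :: v) y <-> exists z, reval f v z /\ prim_steps g v n 0 z y.
Proof.
  revert y; induction n as [| n IH]; intros y.
  - split.
    + intros H; inversion H; subst. exists y; now simpl.
    + intros (z & H & E). simpl in E; subst. now constructor.
  - split.
    + intros H; inversion H as [| | | | | ? ? ? ? x ? H1 H2 |]; subst.
      apply IH in H1 as (z & Hz & H1). exists z; split; auto.
      apply prim_steps_last. eauto.
    + intros (z & Hz & H). apply prim_steps_last in H as (x & H1 & H2).
      apply re_primS with x; auto. apply IH. eauto.
Qed.

(** The trace of the search loop: [m] is the current candidate, [k] the value of [f] there, and [d]
    the number of iterations to come. *)
Fixpoint mu_steps (f : recfun) (v : list nat) (d k m : nat) : Prop :=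
  match d with
  | 0 => k = 0
  | S d' => k <> 0 /\ exists k', reval f (S m :: v) k' /\ mu_steps f v d' k' (S m)
  end.

Lemma reval_mu f v n :
  reval (RMu f) v n <-> exists k, reval f (0 :: v) k /\ mu_steps f v n k 0.
Proof.
  assert (E : forall d m, (exists k, reval f (m :: v) k /\ mu_steps f v d k m) <->
    reval f (m + d :: v) 0 /\
    forall i, i < d -> exists k, reval f (m + i :: v) (S k)).
  { induction d as [| d IH]; intros m; simpl.
    - rewrite Nat.add_0_r. split.
      + intros (k & H & ->). split; auto. lia.
      + intros (H & _); eauto.
    - split.
      + intros (k & Hk & Hk0 & H). apply IH in H as [H1 H2].
        rewrite <- Nat.add_succ_comm. split; auto.
        intros [| i] Hi.
        * rewrite Nat.add_0_r. destruct k as [| k]; [easy | eauto].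
        * rewrite <- Nat.add_succ_comm. apply H2; lia.
      + intros (H1 & H2). destruct (H2 0) as [k Hk]; [lia |].
        rewrite Nat.add_0_r in Hk. exists (S k); repeat split; auto.
        apply IH. rewrite Nat.add_succ_comm. split; auto.
        intros i Hi. rewrite Nat.add_succ_comm. apply H2; lia. }
  rewrite E. simpl. split.
  - intros H; inversion H; subst; auto.
  - intros [H1 H2]; now constructor.
Qed.

Lemma map_upd_other s r x l : ~ In r l -> map (upd s r x) l = map s l.
Proof.
  intros H. apply map_ext_in. intros i Hi. apply upd_other. intros ->; auto.
Qed.

Lemma Forall_lt_notin b (l : list nat) r : Forall (fun i => i < b) l -> b <= r -> ~ In r l.
Proof. intros H Hr Hi. rewrite Forall_forall in H. apply H in Hi. lia. Qed.

Lemma Forall_lt_mono b b' (l : list nat) :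
  b <= b' -> Forall (fun i => i < b) l -> Forall (fun i => i < b') l.
Proof. intros H. apply Forall_impl. lia. Qed.

(** The equivalence also covers undefined values: where [g] has no value, the compiled command has
    no run. *)
Definition correct (g : recfun) : Prop := forall rs o b s t,
  Forall (fun i => i < b) rs -> o < b -> ~ In o rs ->
  (forall r, b <= r -> s r = 0) -> s o = 0 ->
  exec (comp g rs o b) s t <-> exists y, reval g (map s rs) y /\ t = upd s o y.

(** The default value of [nth] leaves the registers past the end of [ws] unchanged. *)
Definition upds (s : state) (j : nat) (ws : list nat) : state :=
  fun i => if i <? j then s i else nth (i - j) ws (s i).

Lemma upds_cons s j w ws : upds s j (w :: ws) = upds (upd s j w) (S j) ws.
Proof.
  extensionality i. unfold upds, upd.
  destruct (Nat.ltb_spec i j), (Nat.ltb_spec i (S j)), (Nat.eq_dec i j); try lia; auto.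
  - subst. now rewrite Nat.sub_diag.
  - replace (i - j) with (S (i - S j)) by lia. reflexivity.
Qed.

(** All arguments lie below the first target, so storing one result does not disturb the inputs of
    the next function. *)
Lemma comps_correct rs B gs : Forall correct gs -> forall j s t,
  Forall (fun i => i < j) rs -> j + length gs <= B -> (forall r, j <= r -> s r = 0) ->
  exec (comps rs B gs j) s t <->
  exists ws, Forall2 (fun g w => reval g (map s rs) w) gs ws /\ t = upds s j ws.
Proof.
  induction 1 as [| g gs Hg _ IH]; intros j s t Hrs HB Hs; cbn [comps].
  - rewrite exec_skip. assert (E : upds s j [] = s).
    { extensionality i. unfold upds. destruct (i <? j), (i - j); reflexivity. }
    split.
    + intros ->. exists []. rewrite E. split; [constructor | reflexivity].
    + intros (ws & H & ->). inversion H; subst. exact E.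
  - simpl in HB. rewrite exec_seq.
    assert (Hj : ~ In j rs) by (apply Forall_lt_notin with j; auto).
    assert (Hg' : forall u, exec (comp g rs j B) s u <->
      exists y, reval g (map s rs) y /\ u = upd s j y).
    { intros u. apply Hg; auto; try lia.
      - apply (Forall_lt_mono j); auto; lia.
      - intros r Hr. apply Hs; lia. }
    assert (IH' : forall y, exec (comps rs B gs (S j)) (upd s j y) t <->
      exists ws, Forall2 (fun g w => reval g (map s rs) w) gs ws /\
        t = upds s j (y :: ws)).
    { intros y. rewrite IH.
      - rewrite map_upd_other by auto. now setoid_rewrite upds_cons.
      - apply (Forall_lt_mono j); auto.
      - lia.
      - intros r Hr. rewrite upd_other by lia. apply Hs; lia. }
    split.
    + intros (u & Hu & H). apply Hg' in Hu as (y & Hy & ->).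
      apply IH' in H as (ws & Hws & ->). exists (y :: ws); auto.
    + intros (ws & H & ->). inversion H as [| ? y ? ws' Hy Hws]; subst.
      exists (upd s j y). split; [apply Hg' | apply IH']; eauto.
Qed.

Lemma correct_RComp f gs : correct f -> Forall correct gs -> correct (RComp f gs).
Proof.
  intros Hf Hgs rs o b s t Hrs Ho Hor Hs Hso. rewrite comp_RComp, exec_seq.
  setoid_rewrite exec_seq. setoid_rewrite exec_clears.
  set (m := length gs).
  assert (Hgs' := fun u => comps_correct rs (b + m) gs Hgs b s u Hrs (le_n _) Hs).
  setoid_rewrite Hgs'. clear Hgs Hgs'.
  assert (Hf' : forall ws u, length ws = m ->
    exec (comp f (seq b m) o (b + m)) (upds s b ws) u <->
    exists y, reval f ws y /\ u = upd (upds s b ws) o y).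
  { intros ws u Hl. unfold correct in Hf. rewrite Hf.
    - replace (map (upds s b ws) (seq b m)) with ws; [reflexivity |].
      apply nth_ext with 0 0; [now rewrite length_map, length_seq |].
      intros i Hi. rewrite (nth_indep (map _ _) 0 (upds s b ws 0))
        by (rewrite length_map, length_seq; lia).
      rewrite map_nth, seq_nth by lia. unfold upds.
      destruct (Nat.ltb_spec (b + i) b); [lia |].
      rewrite Nat.add_comm, Nat.add_sub. now apply nth_indep.
    - apply Forall_forall. intros i Hi. apply in_seq in Hi. lia.
    - lia.
    - rewrite in_seq. lia.
    - intros r Hr. unfold upds. destruct (Nat.ltb_spec r b); [lia |].
      rewrite nth_overflow by lia. apply Hs; lia.
    - unfold upds. destruct (Nat.ltb_spec o b); [auto | lia]. }
  (* Clearing the intermediate results restores [s], which is zero on the scratch registers. *)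
  assert (E : forall ws y, length ws = m ->
    (fun i => if in_dec Nat.eq_dec i (seq b m) then 0 else upd (upds s b ws) o y i)
    = upd s o y).
  { intros ws y Hl. extensionality i. unfold upd, upds.
    destruct (in_dec Nat.eq_dec i (seq b m)) as [Hi | Hi]; rewrite in_seq in Hi;
      destruct (Nat.eq_dec i o), (Nat.ltb_spec i b); try lia.
    - symmetry; apply Hs; lia.
    - apply nth_overflow; lia. }
  split.
  - intros (u & (ws & Hws & ->) & v & Hv & ->).
    assert (Hl := Forall2_length Hws). fold m in Hl.
    apply Hf' in Hv as (y & Hy & ->); [| auto]. exists y. rewrite E by auto.
    split; auto. econstructor; eauto.
  - intros (y & Hy & ->). inversion Hy as [| | | ? ? ? ws ? Hws Hy' | | |]; subst.
    assert (Hl := Forall2_length Hws). fold m in Hl.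
    exists (upds s b ws); split; [eauto |].
    exists (upd (upds s b ws) o y). rewrite E by auto. split; auto.
    apply Hf'; eauto.
Qed.

(** Register [b] counts the iterations left, [b + 1] holds the index, [o] the accumulator, and
    [b + 2] the freshly computed value. *)
Lemma correct_RPrim f g : correct f -> correct g -> correct (RPrim f g).
Proof.
  intros Hf Hg [| a rs] o b s t Hrs Ho Hor Hs Hso; cbn [comp].
  { split.
    - intros H. apply exec_dec0 in H; [contradiction | now apply Hs].
    - intros (y & H & _). inversion H. }
  apply Forall_cons_iff in Hrs as [Ha Hrs].
  apply not_in_cons in Hor as [Hoa Hor].
  assert (Hbrs : forall k, ~ In (b + k) rs) by (intros k; eapply Forall_lt_notin; eauto; lia).
  assert (Hbrs0 : ~ In b rs) by (eapply Forall_lt_notin; eauto).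
  set (body := Seq (comp g _ _ _) _).
  (* The step function still reads [o], so its value goes to [b + 2] and is moved to [o]
     afterwards. *)
  assert (Hbody : forall u u', u (b + 2) = 0 -> (forall r, b + 3 <= r -> u r = 0) ->
    exec body u u' <->
    exists y, reval g (u (b + 1) :: u o :: map u rs) y /\
      u' = upd (upd u (b + 1) (S (u (b + 1)))) o y).
  { intros u u' Hu2 Hu. unfold body. rewrite exec_seq.
    setoid_rewrite exec_seq. setoid_rewrite exec_clear.
    setoid_rewrite exec_seq. setoid_rewrite exec_inc.
    setoid_rewrite exec_move; [| lia].
    assert (Hg' : forall v, exec (comp g (b + 1 :: o :: rs) (b + 2) (b + 3)) u v <->
      exists y, reval g (u (b + 1) :: u o :: map u rs) y /\ v = upd u (b + 2) y).
    { intros v. unfold correct in Hg. rewrite Hg; auto; try lia.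
      - reflexivity.
      - repeat constructor; try lia. apply (Forall_lt_mono b); auto; lia.
      - simpl. intros [H | [H | H]]; [lia | lia | exact (Hbrs 2 H)]. }
    assert (E : forall y, let v := upd (upd u (b + 2) y) o 0 in
      let w := upd (upd v (b + 2) 0) o (v o + v (b + 2)) in
      upd w (b + 1) (S (w (b + 1))) = upd (upd u (b + 1) (S (u (b + 1)))) o y).
    { intros y v w.
      assert (Ew : w = upd u o y).
      { unfold w, v. rewrite upd_same, upd_other, upd_same by lia. simpl. upd_ext. }
      rewrite Ew. rewrite upd_other by lia. upd_ext. }
    split.
    - intros (v & Hv & w & -> & x & -> & ->). apply Hg' in Hv as (y & Hy & ->).
      exists y. split; [exact Hy | apply E].
    - intros (y & Hy & ->). exists (upd u (b + 2) y). split; [apply Hg'; eauto |].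
      eexists; split; [reflexivity |]. eexists; split; [reflexivity |].
      symmetry; apply E. }
  assert (Hloop : forall m u u', u b = m -> u (b + 2) = 0 ->
    (forall r, b + 3 <= r -> u r = 0) ->
    exec (Loop b body) u u' <->
    exists y, prim_steps g (map u rs) m (u (b + 1)) (u o) y /\
      u' = upd (upd (upd u b 0) (b + 1) (u (b + 1) + m)) o y).
  { induction m as [| m IH]; intros u u' Hub Hu2 Hu; rewrite exec_loop, Hub.
    - simpl. rewrite Nat.add_0_r. assert (E : upd (upd (upd u b 0) (b + 1) (u (b + 1))) o (u o) = u)
        by upd_ext.
      split.
      + intros [[_ ->] | (? & ? & ? & _)]; [eauto | discriminate].
      + intros (y & -> & ->). left; auto.
    - assert (Hbody' := fun v => Hbody (upd u b m) v).
      rewrite (upd_other _ b), (upd_other _ b), (upd_other _ b), map_upd_other in Hbody'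
        by (auto; lia).
      assert (IH' : forall y, exec (Loop b body)
          (upd (upd (upd u b m) (b + 1) (S (u (b + 1)))) o y) u' <->
        exists z, prim_steps g (map u rs) m (S (u (b + 1))) y z /\
          u' = upd (upd (upd u b 0) (b + 1) (u (b + 1) + S m)) o z).
      { intros y.
        set (w := upd (upd (upd u b m) (b + 1) (S (u (b + 1)))) o y).
        assert (Ew : w b = m /\ w (b + 2) = 0 /\ w (b + 1) = S (u (b + 1)) /\ w o = y).
        { unfold w. repeat split;
            repeat (rewrite upd_same || rewrite upd_other by lia); auto. }
        destruct Ew as (E0 & E2 & E1 & Eo).
        rewrite IH; auto.
        - rewrite E1, Eo. unfold w at 1. rewrite !map_upd_other by auto.
          assert (E : forall z, upd (upd (upd w b 0) (b + 1) (S (u (b + 1)) + m)) o z =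
            upd (upd (upd u b 0) (b + 1) (u (b + 1) + S m)) o z)
            by (intros z; unfold w; clear - Ho; upd_ext).
          setoid_rewrite E. reflexivity.
        - intros r Hr. unfold w. rewrite !upd_other by lia. auto. }
      assert (Hc : forall r, b + 3 <= r -> upd u b m r = 0)
        by (intros r Hr; rewrite upd_other by lia; auto).
      split.
      + intros [[? _] | (m' & v & Em & Hv & Hl)]; [discriminate |].
        injection Em as <-. apply Hbody' in Hv as (y & Hy & ->); auto.
        apply IH' in Hl as (z & Hz & ->). exists z; split; auto. simpl; eauto.
      + intros (z & (y & Hy & Hz) & ->). right.
        exists m, (upd (upd (upd u b m) (b + 1) (S (u (b + 1)))) o y).
        split; [reflexivity |]. split; [apply Hbody' | apply IH']; eauto. }
  clearbody body. clear Hbody.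
  assert (Hcopy : forall u, exec (copy a b (b + 2)) s u <-> u = upd s b (s a)).
  { intros u. apply exec_copy; try lia; apply Hs; lia. }
  (* With [copy] abstract, the rewriting by [exec_seq] splits only the outer sequence. *)
  generalize dependent (copy a b (b + 2)). intros cp Hcopy.
  repeat setoid_rewrite exec_seq.
  setoid_rewrite exec_clear.
  setoid_rewrite Hcopy.
  set (s1 := upd s b (s a)).
  assert (Hm1 : map s1 rs = map s rs) by (now apply map_upd_other).
  assert (Hf' : forall u, exec (comp f rs o (b + 3)) s1 u <->
    exists y, reval f (map s rs) y /\ u = upd s1 o y).
  { intros u. unfold correct in Hf. rewrite Hf; [now rewrite Hm1 | | lia | auto | |].
    - apply (Forall_lt_mono b); auto; lia.
    - intros r Hr. unfold s1. rewrite upd_other by lia. apply Hs; lia.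
    - unfold s1. rewrite upd_other by lia. auto. }
  assert (Hloop' : forall z u, exec (Loop b body) (upd s1 o z) u <->
    exists y, prim_steps g (map s rs) (s a) 0 z y /\
      u = upd (upd (upd s b 0) (b + 1) (s a)) o y).
  { intros z u. rewrite (Hloop (s a)).
    - rewrite upd_same, (upd_other _ o) by lia. unfold s1 at 2 4.
      rewrite (upd_other _ b), (Hs (b + 1)), map_upd_other, Hm1 by (auto; lia).
      assert (E : forall y, upd (upd (upd (upd s1 o z) b 0) (b + 1) (0 + s a)) o y =
        upd (upd (upd s b 0) (b + 1) (s a)) o y) by (intros y; unfold s1; upd_ext).
      setoid_rewrite E. reflexivity.
    - rewrite upd_other by lia. apply upd_same.
    - rewrite upd_other by lia. unfold s1. rewrite upd_other by lia. apply Hs; lia.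
    - intros r Hr. rewrite upd_other by lia. unfold s1.
      rewrite upd_other by lia. apply Hs; lia. }
  assert (E : forall y, upd (upd (upd (upd s b 0) (b + 1) (s a)) o y) (b + 1) 0 = upd s o y).
  { intros y. pose proof (Hs b (le_n b)). assert (s (b + 1) = 0) by (apply Hs; lia). upd_ext. }
  cbn [map]. setoid_rewrite reval_prim. split.
  - intros (u & -> & v & Hv & w & Hw & ->).
    apply Hf' in Hv as (z & Hz & ->). apply Hloop' in Hw as (y & Hy & ->).
    exists y. rewrite E. eauto.
  - intros (y & (z & Hz & Hy) & ->). exists s1; split; auto.
    exists (upd s1 o z). rewrite Hf'. split; [eauto |].
    eexists; split; [apply Hloop'; eauto |]. now rewrite E.
Qed.

(** Register [o] holds the candidate and [b] the value of [f] there; the loop exits when this value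
    is zero, leaving the result in [o]. *)
Lemma correct_RMu f : correct f -> correct (RMu f).
Proof.
  intros Hf rs o b s t Hrs Ho Hor Hs Hso; cbn [comp].
  assert (Hbrs : ~ In b rs) by (eapply Forall_lt_notin; eauto).
  set (body := Seq (clear b) _).
  assert (Hf' : forall u u', u b = 0 -> (forall r, b + 1 <= r -> u r = 0) ->
    exec (comp f (o :: rs) b (b + 1)) u u' <->
    exists k, reval f (u o :: map u rs) k /\ u' = upd u b k).
  { intros u u' Hb Hu. apply Hf; auto; try lia.
    - constructor; [lia |]. apply (Forall_lt_mono b); auto; lia.
    - simpl. intros [H | H]; [lia | auto]. }
  assert (Hbody : forall u u', (forall r, b + 1 <= r -> u r = 0) ->
    exec body u u' <->
    exists k, reval f (S (u o) :: map u rs) k /\ u' = upd (upd u o (S (u o))) b k).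
  { intros u u' Hu. unfold body. rewrite exec_seq. setoid_rewrite exec_clear.
    setoid_rewrite exec_seq. setoid_rewrite exec_inc.
    set (w := upd (upd u b 0) o (S (u o))).
    assert (Hw : forall u', exec (comp f (o :: rs) b (b + 1)) w u' <->
      exists k, reval f (S (u o) :: map u rs) k /\ u' = upd (upd u o (S (u o))) b k).
    { intros x. rewrite Hf'.
      - unfold w at 1 2. rewrite upd_same, !map_upd_other by auto.
        assert (E : forall k, upd w b k = upd (upd u o (S (u o))) b k)
          by (intros k; unfold w; upd_ext).
        now setoid_rewrite E.
      - unfold w. rewrite upd_other by lia. apply upd_same.
      - intros r Hr. unfold w. rewrite !upd_other by lia. auto. }
    rewrite <- Hw. assert (Eo : upd u b 0 o = u o) by (rewrite upd_other; auto; lia).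
    split.
    - intros (v & -> & x & -> & H). rewrite Eo in H. exact H.
    - intros H. eexists; split; [reflexivity |]. eexists; split; [reflexivity |].
      rewrite Eo. exact H. }
  clearbody body.
  assert (Hloop : forall u u', (forall r, b + 1 <= r -> u r = 0) ->
    exec (Loop b body) u u' <->
    exists d, mu_steps f (map u rs) d (u b) (u o) /\
      u' = upd (upd u b 0) o (u o + d)).
  { intros u u' Hu.
    (* The body clears [b] first, so the value [m] left there by the decrement of the loop is
       irrelevant. *)
    assert (Hstep : forall u m v, (forall r, b + 1 <= r -> u r = 0) ->
      exec body (upd u b m) v <-> exists k, reval f (S (u o) :: map u rs) k /\
        v = upd (upd u o (S (u o))) b k).
    { clear - Hbody Hbrs Ho. intros u m v Hu.
      rewrite Hbody by (intros r Hr; rewrite upd_other by lia; auto).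
      rewrite (upd_other u b), map_upd_other by (auto; lia).
      assert (E : forall k, upd (upd (upd u b m) o (S (u o))) b k =
        upd (upd u o (S (u o))) b k) by (intros k; upd_ext).
      now setoid_rewrite E. }
    assert (Hnext : forall u k, (forall r, b + 1 <= r -> u r = 0) ->
      let w := upd (upd u o (S (u o))) b k in
      (forall r, b + 1 <= r -> w r = 0) /\ map w rs = map u rs /\ w b = k /\
      w o = S (u o) /\
      forall d, upd (upd w b 0) o (S (u o) + d) = upd (upd u b 0) o (u o + S d)).
    { clear - Hbrs Ho Hor. intros u k Hu w. unfold w. repeat split.
      - intros r Hr. rewrite !upd_other by lia. auto.
      - now rewrite !map_upd_other.
      - apply upd_same.
      - rewrite upd_other by lia. apply upd_same.
      - intros d. upd_ext. }
    split.
    (* The number of iterations is not known beforehand, so this direction goes by induction on the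
       execution. *)
    - intros H. remember (Loop b body) as c eqn:Ec.
      revert Ec Hu; induction H; intros Ec Hu; inversion Ec; subst.
      + exists 0. split; [assumption |]. rewrite Nat.add_0_r. upd_ext.
      + apply Hstep in H0 as (k & Hk & ->); auto.
        destruct (Hnext s0 k Hu) as (N1 & N2 & N3 & N4 & N5).
        destruct (IHexec2 eq_refl N1) as (d & Hd & ->).
        exists (S d). rewrite N2, N3, N4 in Hd. rewrite N4, N5.
        split; auto. simpl. split; [congruence | eauto].
    - intros (d & Hd & ->). revert u Hu Hd.
      induction d as [| d IH]; intros u Hu Hd; simpl in Hd.
      + apply exec_loop; left. split; auto. rewrite Nat.add_0_r. upd_ext.
      + destruct Hd as (Hb & k & Hk & Hd).
        destruct (Hnext u k Hu) as (N1 & N2 & N3 & N4 & N5).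
        specialize (IH _ N1). rewrite N2, N3, N4, N5 in IH.
        apply exec_loop; right. destruct (u b) as [| m]; [easy |].
        exists m. eexists. split; [reflexivity |]. split; [| exact (IH Hd)].
        apply Hstep; eauto. }
  rewrite exec_seq. setoid_rewrite reval_mu.
  assert (Hloop' : forall k, exec (Loop b body) (upd s b k) t <->
    exists d, mu_steps f (map s rs) d k 0 /\ t = upd s o d).
  { intros k. rewrite Hloop by (intros r Hr; rewrite upd_other by lia; apply Hs; lia).
    rewrite map_upd_other, upd_same, (upd_other s b), Hso by (auto; lia).
    assert (E : forall d, upd (upd (upd s b k) b 0) o (0 + d) = upd s o d)
      by (intros d; pose proof (Hs b (le_n b)); upd_ext).
    now setoid_rewrite E. }
  assert (Hs' := fun u => Hf' s u (Hs b (le_n b)) ltac:(intros; apply Hs; lia)).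
  rewrite Hso in Hs'. split.
  - intros (u & Hu & H). apply Hs' in Hu as (k & Hk & ->).
    apply Hloop' in H as (d & Hd & ->). eauto.
  - intros (d & (k & Hk & Hd) & ->). exists (upd s b k).
    split; [apply Hs' | apply Hloop']; eauto.
Qed.

Theorem comp_correct g : correct g.
Proof.
  induction g as [| | i | f gs IHf IHgs | f g IHf IHg | f IHf] using recfun_nested_ind;
    auto using correct_RComp, correct_RPrim, correct_RMu;
    intros rs o b s t Hrs Ho Hor Hs Hso; cbn [comp].
  - rewrite exec_skip. split.
    + intros ->. exists 0. split; [constructor | now rewrite upd_id].
    + intros (y & Hy & ->). inversion Hy; subst. now rewrite upd_id.
  - destruct rs as [| a rs].
    + split.
      * intros H. apply exec_dec0 in H; [contradiction | now apply Hs].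
      * intros (y & Hy & _). inversion Hy.
    + apply Forall_cons_iff in Hrs as [Ha _]. apply not_in_cons in Hor as [Hoa _].
      rewrite exec_seq. setoid_rewrite exec_inc.
      assert (Hc := fun u => exec_copy a o b s u ltac:(lia) ltac:(lia) ltac:(lia)
        Hso (Hs b (le_n b))).
      setoid_rewrite Hc. cbn [map].
      assert (E : upd (upd s o (s a)) o (S (upd s o (s a) o)) = upd s o (S (s a)))
        by (rewrite upd_same; upd_ext).
      split.
      * intros (u & -> & ->). exists (S (s a)). split; [constructor | exact E].
      * intros (y & Hy & ->). inversion Hy; subst. eauto.
  - destruct (Nat.ltb_spec i (length rs)) as [Hi | Hi].
    + assert (Hin : In (nth i rs 0) rs) by now apply nth_In.
      assert (Hlt : nth i rs 0 < b) by (rewrite Forall_forall in Hrs; auto).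
      assert (Hne : nth i rs 0 <> o) by congruence.
      rewrite exec_copy by (auto; lia).
      assert (E : s (nth i rs 0) = nth i (map s rs) 0).
      { rewrite (nth_indep (map s rs) 0 (s 0)) by (now rewrite length_map). now rewrite map_nth. }
      rewrite E. split.
      * intros ->. eexists; split; [| reflexivity]. constructor. now rewrite length_map.
      * intros (y & Hy & ->). now inversion Hy.
    + split.
      * intros H. apply exec_dec0 in H; [contradiction | now apply Hs].
      * intros (y & Hy & _). inversion Hy; subst. rewrite length_map in *. lia.
Qed.

Lemma program_clears l : program (clears l).
Proof. induction l; simpl; auto. Qed.

Lemma program_comp g : forall rs o b, program (comp g rs o b).
Proof.
  induction g as [| | i | f gs IHf IHgs | f g IHf IHg | f IHf] using recfun_nested_ind;
    intros rs o b.
  - exact I.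
  - destruct rs; simpl; auto.
  - simpl. destruct (i <? length rs); simpl; auto.
  - assert (Hgs : forall B j, program (comps rs B gs j)).
    { induction IHgs as [| g gs Hg _ IH]; simpl; auto. }
    rewrite comp_RComp. simpl. auto using program_clears.
  - destruct rs; simpl; repeat split; auto.
  - simpl; repeat split; auto.
Qed.

(** * The diagonal sequent *)

Fixpoint rconst (n : nat) : recfun :=
  match n with 0 => RZero | S n' => RComp RSucc [rconst n'] end.

Lemma reval_const n v : reval (rconst n) v n.
Proof.
  induction n as [| n IH]; simpl; [constructor |].
  apply re_comp with [n]; [auto | constructor].
Qed.

Lemma reval_proj i v x : nth_error v i = Some x -> reval (RProj i) v x.
Proof.
  intros H. rewrite <- (nth_error_nth v i 0 H). constructor.
  apply nth_error_Some. congruence.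
Qed.

Definition rsucc (f : recfun) : recfun := RComp RSucc [f].

Lemma reval_succ f v x : reval f v x -> reval (rsucc f) v (S x).
Proof. intros H. apply re_comp with [x]; [auto | constructor]. Qed.

Definition radd (f g : recfun) : recfun := RComp (RPrim (RProj 0) (rsucc (RProj 1))) [f; g].

Lemma reval_add f g v x y : reval f v x -> reval g v y -> reval (radd f g) v (x + y).
Proof.
  intros Hf Hg. apply re_comp with [x; y]; [auto |]. clear.
  induction x as [| x IH]; simpl.
  - apply re_prim0, reval_proj. reflexivity.
  - eapply re_primS; [exact IH |]. apply reval_succ, reval_proj. reflexivity.
Qed.

(** The quotient in [cpair] is a triangular number, which primitive recursion computes by summation
    without division. *)
Fixpoint triangle (n : nat) : nat := match n with 0 => 0 | S n' => triangle n' + S n' end.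

Lemma cpair_triangle a b : cpair a b = triangle (a + b) + b.
Proof.
  unfold cpair. f_equal. generalize (a + b) as n. clear. intros n.
  symmetry; apply Nat.div_unique_exact; [lia |].
  induction n as [| n IH]; simpl triangle; lia.
Qed.

Definition rtriangle : recfun := RPrim RZero (radd (RProj 1) (rsucc (RProj 0))).

Lemma reval_triangle n : reval rtriangle [n] (triangle n).
Proof.
  induction n as [| n IH]; simpl.
  - apply re_prim0. constructor.
  - eapply re_primS; [exact IH |].
    apply reval_add; [| apply reval_succ]; now apply reval_proj.
Qed.

Definition rpair (f g : recfun) : recfun := radd (RComp rtriangle [radd f g]) g.

Lemma reval_pair f g v x y : reval f v x -> reval g v y -> reval (rpair f g) v (cpair x y).
Proof.
  intros Hf Hg. rewrite cpair_triangle. apply reval_add; auto.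
  apply re_comp with [x + y]; [| apply reval_triangle].
  constructor; [now apply reval_add | constructor].
Qed.

Definition var_tree (c : cmd) : tree := TF (Var (code c)).

(** The input is written in unary in front of [L], so that [L] can be fixed first and its code then
    used as [k]. *)
Definition halting_sequent (k : nat) (L : list tree) : sequent :=
  (([], var_tree Reset :: repeat (var_tree (Inc 0)) k ++ L), One).

Definition program_trees (c : cmd) (R : list (list cmd * list cmd)) : list tree :=
  var_tree c :: var_tree Any :: rules_trees (map_rules code R).

Lemma halting_sequent_derivable c R k :
  derivable_seq (halting_sequent k (program_trees c R)) <->
  rew R (Reset :: repeat (Inc 0) k ++ [c; Any]) [].
Proof.
  assert (E : var_tree Reset :: repeat (var_tree (Inc 0)) k ++ program_trees c R =
    word_trees (map code (Reset :: repeat (Inc 0) k ++ [c; Any])) ++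
    rules_trees (map_rules code R)).
  { unfold word_trees. simpl. rewrite !map_app, !map_repeat, <- app_assoc. reflexivity. }
  unfold derivable_seq; simpl. rewrite E. split.
  - intros H. apply derivable_rew in H.
    exact (rew_map_inv code code_injective _ _ [] H).
  - intros H. apply rew_derivable. exact (rew_map code _ _ _ H).
Qed.

(* The code of [halting_sequent k L], given [k = enc_list enc_tree L]. *)
Definition rsequent : recfun :=
  let cons t f := rsucc (rpair (rconst (enc_tree t)) f) in
  rpair (rpair (rconst 0) (cons (var_tree Reset)
    (RComp (RPrim (RProj 0) (cons (var_tree (Inc 0)) (RProj 1))) [RProj 0; RProj 0])))
  (rconst (enc_formula One)).

(** Since [k] is the code of [L], prefixing [k] increments amounts to iterating the coded cons [k]
    times from [k] itself. Hence [rsequent] need not contain [L], and no circularity arises. *)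
Lemma reval_sequent L :
  let k := enc_list enc_tree L in
  reval rsequent [k] (enc_sequent (halting_sequent k L)).
Proof.
  intros k.
  assert (Hcons : forall t f v G, reval f v (enc_list enc_tree G) ->
    reval (rsucc (rpair (rconst (enc_tree t)) f)) v (enc_list enc_tree (t :: G))).
  { intros t f v G H. apply reval_succ, reval_pair; auto using reval_const. }
  unfold rsequent, halting_sequent, enc_sequent, enc_meta.
  apply reval_pair; [| apply reval_const].
  apply reval_pair; [apply reval_const |].
  (* The first [k] is the number of iterations, the second the code of the tail. *)
  apply Hcons. apply re_comp with [k; k].
  - repeat constructor.
  - enough (H : forall n, reval
      (RPrim (RProj 0) (rsucc (rpair (rconst (enc_tree (var_tree (Inc 0)))) (RProj 1))))
      [n; k] (enc_list enc_tree (repeat (var_tree (Inc 0)) n ++ L))) by apply H.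
    induction n as [| n IH].
    + apply re_prim0, reval_proj. reflexivity.
    + eapply re_primS; [exact IH |]. apply Hcons, reval_proj. reflexivity.
Qed.

Theorem theorem8 : ~ decidable_sequent_problem derivable_seq.
Proof.
  intros [f Hf].
  set (g := RComp f [rsequent]).
  (* Input in register [0], output in [1], scratch from [2]. The final [Dec 1] blocks exactly on the
     output [0], the answer for a derivable sequent. *)
  set (c := Seq (comp g [0] 1 2) (Dec 1)).
  assert (Hc : forall k, (exists t, exec c (upd (fun _ => 0) 0 k) t) <->
    exists y, reval g [k] (S y)).
  { intros k. set (s := upd (fun _ => 0) 0 k).
    assert (Hs : forall r, r <> 0 -> s r = 0) by (intros r Hr; now apply upd_other).
    assert (Hg : forall u, exec (comp g [0] 1 2) s u <->
      exists y, reval g [k] y /\ u = upd s 1 y).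
    { intros u. apply comp_correct; auto; [simpl; lia | intros r Hr; apply Hs; lia]. }
    unfold c. setoid_rewrite exec_seq. split.
    - intros (t & u & Hu & Ht). apply Hg in Hu as (y & Hy & ->).
      inversion Ht as [| ? ? m E | | | | | | |]; subst. rewrite upd_same in E. subst. eauto.
    - intros (y & Hy). eexists; exists (upd s 1 (S y)). split; [apply Hg; eauto |].
      constructor. apply upd_same. }
  assert (Hp : program c) by (split; [apply program_comp | exact I]).
  destruct (program_rew c Hp) as [R HR].
  set (k := enc_list enc_tree (program_trees c R)).
  set (sq := halting_sequent k (program_trees c R)).
  (* On input [k] the program evaluates [f] at the code of [sq], the very sequent that expresses its
     halting on [k]. *)
  assert (Hsq : derivable_seq sq <-> exists y, reval f [enc_sequent sq] (S y)).
  { unfold sq. rewrite halting_sequent_derivable, <- HR, Hc. unfold g.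
    assert (Hk := reval_sequent (program_trees c R)). cbn zeta in Hk. fold k in Hk.
    split; intros [y Hy]; exists y.
    - inversion Hy as [| | | ? ? ? ws ? Hws Hy' | | |]; subst.
      inversion Hws as [| ? w ? ws' Hw Hnil]; subst. inversion Hnil; subst.
      now rewrite (reval_functional _ _ _ _ Hk Hw).
    - econstructor; [| exact Hy]. auto. }
  destruct (Hf sq) as [H0 H1].
  (* A derivation forces the answer [0], whereas [Hsq] then yields a successor. Without a derivation
     the answer is [1], which by [Hsq] gives one. *)
  assert (Hn : ~ derivable_seq sq).
  { intros Hd. specialize (H0 Hd). apply Hsq in Hd as [y Hy].
    discriminate (reval_functional _ _ _ _ H0 Hy). }
  apply Hn, Hsq. exists 0. now apply H1.
Qed.
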